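(* Let $n\ge 2$ and, for a bounded continuous function $u:\mathbb{R}^n\to\mathbb{R}$ and $t>0$, let $$u_t(x)=\inf_{y\in\mathbb{R}^n}\Big(u(y)+\frac{|x-y|^2}{2t}\Big).$$ There exist a continuous and compactly supported function $u\in W^{1,n}(\mathbb{R}^n)$ and a measurable set $E\subset\mathbb{R}^n$ of positive Lebesgue measure such that for every $x\in E$ one has $|Du_t(x)|\to\infty$ as $t\to 0^+$, i.e. for every $x\in E$ and every $K>0$ there is $\delta>0$ such that $|Du_t(x)|>K$ for all $t\in(0,\delta)$ for which $u_t$ is differentiable at $x$.
   Context: The function $u_t$ is the infimal convolution $u_t(x)=\inf_y\big(u(y)+tL(\tfrac{y-x}{t})\big)$ with $L(q)=\tfrac12|q|^2$. For bounded continuous $u$ and each $t>0$ it is Lipschitz on $\mathbb{R}^n$, hence differentiable almost everywhere. *)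

(* Defs.v *)
From HB Require Import structures.
From mathcomp Require Import all_boot all_order all_algebra.
From mathcomp Require Import all_classical all_reals all_analysis.
From mathcomp Require Import measurable_realfun.

Set Implicit Arguments.
Unset Strict Implicit.
Unset Printing Implicit Defensive.

Import Order.TTheory GRing.Theory Num.Theory.
Import numFieldNormedType.Exports.

Local Open Scope classical_set_scope.
Local Open Scope ring_scope.

Definition borel_rV_display : measure_display.
Proof. exact: default_measure_display. Qed.

Section borel_rV.
Context {R : realType} {n : nat}.

Definition borel_rV : set (set 'rV[R]_n) := <<s @open 'rV[R]_n >>.

Let borel_rV0 : borel_rV set0.
Proof. exact: sigma_algebra0. Qed.

Let borel_rVC A : borel_rV A -> borel_rV (~` A).
Proof. exact: sigma_algebraC. Qed.

Let borel_rV_bigcup (F : (set 'rV[R]_n)^nat) :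
  (forall i, borel_rV (F i)) -> borel_rV (\bigcup_i F i).
Proof. exact: sigma_algebra_bigcup. Qed.

HB.instance Definition _ := @isMeasurable.Build borel_rV_display
  'rV[R]_n borel_rV borel_rV0 borel_rVC borel_rV_bigcup.

End borel_rV.

Section measurability.
Context {R : realType}.

Lemma measurable_open_rV n (U : set 'rV[R]_n) : open U -> measurable U.
Proof. by move=> oU; exact: sub_sigma_algebra. Qed.

Lemma measurable_coord n (i : 'I_n) :
  measurable_fun [set: 'rV[R]_n] (fun x => x ord0 i).
Proof.
apply: (measurability _ (RGenOpens.measurableE R)) => _ [_ [a [b ->] <-]].
rewrite setTI; apply: measurable_open_rV.
apply: open_comp; first by move=> ? _; exact: coord_continuous.
exact: interval_open.
Qed.

Lemma open_rV_bigcup n (U : set 'rV[R]_n) : open U ->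
  exists (D : set nat) (F : ('I_n -> interval R)^nat),
    U = \bigcup_(k in D) [set x | forall i, x ord0 i \in F k i].
Proof.
move=> oU.
pose I (q : {ffun 'I_n -> rat * rat}) (i : 'I_n) : interval R :=
  `]ratr (q i).1, ratr (q i).2[.
pose F k := if unpickle k is Some q then I q else fun=> `]0, 0[.
pose B k := [set x : 'rV[R]_n | forall i, x ord0 i \in F k i].
exists [set k | B k `<=` U], F; apply/seteqP; split=> [x Ux|x [k BU]]; last first.
  exact: BU.
have /nbhs_ballP[e /= e0 xeU] : nbhs x U by exact: open_nbhs_nbhs.
have /choice[q qP] (i : 'I_n) : exists q : rat * rat,
    x ord0 i - e < ratr q.1 < x ord0 i /\ x ord0 i < ratr q.2 < x ord0 i + e.
  have /rat_in_itvoo[a] : x ord0 i - e < x ord0 i by rewrite ltrBlDr ltrDl.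
  have /rat_in_itvoo[b] : x ord0 i < x ord0 i + e by rewrite ltrDl.
  by rewrite !in_itv/= => hb ha; exists (a, b).
exists (pickle [ffun i => q i]); rewrite /B /F /= pickleK /I /=.
  move=> y /= yq; apply: xeU; split => // j i; rewrite (ord1 j).
  move: (yq i); rewrite ffunE in_itv/= /ball/= ltr_norml.
  have [/andP[q1 q2] /andP[q3 q4]] := qP i => /andP[y1 y2].
  apply/andP; split.
    by rewrite ltrBrDr addrC ltrBlDl (lt_trans y2)// addrC.
  by rewrite ltrBlDr -ltrBlDl (lt_trans q1).
by move=> i; rewrite ffunE in_itv/=; have [/andP[_ ->] /andP[->]] := qP i.
Qed.

Lemma measurable_fun_rVP d (T : measurableType d) n (f : T -> 'rV[R]_n) :
  (forall i, measurable_fun setT (fun t => f t ord0 i)) ->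
  measurable_fun setT f.
Proof.
move=> mf; apply: (@measurability _ _ _ _ _ _ (@open 'rV[R]_n)) => //.
move=> _ [U oU <-]; have [D [F ->]] := open_rV_bigcup oU.
rewrite setTI preimage_bigcup; apply: bigcup_measurable => k _.
rewrite [X in measurable X](_ : _ =
  \bigcap_(i in [set: 'I_n]) ((fun t => f t ord0 i) @^-1` [set` F k i])).
  apply: fin_bigcap_measurable => // i _; rewrite -[X in measurable X]setTI.
  by apply: mf => //; exact: measurable_itv.
by apply/seteqP; split=> t /= ft i; [move=> _; exact: ft|exact: (ft i I)].
Qed.

Lemma measurable_rV_box n (A : 'I_n -> set R) : (forall i, measurable (A i)) ->
  measurable [set x : 'rV[R]_n | forall i, A i (x ord0 i)].
Proof.
move=> mA; rewrite [X in measurable X](_ : _ =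
  \bigcap_(i in [set: 'I_n]) ((fun x : 'rV[R]_n => x ord0 i) @^-1` A i)).
  apply: fin_bigcap_measurable => // i _; rewrite -[X in measurable X]setTI.
  by apply: measurable_coord => //; exact: mA.
by apply/seteqP; split=> x /= Ax i; [move=> _; exact: Ax|exact: (Ax i I)].
Qed.

End measurability.

Section lebesgue_rV.
Context {R : realType}.

Definition rV_cons n (p : measurableTypeR R * 'rV[R]_n) : 'rV[R]_n.+1 :=
  \row_i oapp (fun j => p.2 ord0 j) p.1 (unlift ord0 i).

Lemma measurable_rV_cons n : measurable_fun setT (@rV_cons n).
Proof.
apply: measurable_fun_rVP => i.
case: (unliftP ord0 i) => [j ->|->].
  under eq_fun do rewrite mxE liftK/=.
  exact: (measurableT_comp (measurable_coord j) measurable_snd).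
under eq_fun do rewrite mxE unlift_none/=.
exact: measurable_fst.
Qed.

HB.instance Definition _ n :=
  isMeasurableFun.Build _ _ _ _ (@rV_cons n) (@measurable_rV_cons n).

Definition rV_uncons n (x : 'rV[R]_n.+1) : measurableTypeR R * 'rV[R]_n :=
  (x ord0 ord0, \row_j x ord0 (lift ord0 j)).

Lemma rV_consK n : cancel (@rV_cons n) (@rV_uncons n).
Proof.
move=> [a v]; congr pair; first by rewrite mxE unlift_none.
by apply/rowP => j; rewrite !mxE liftK.
Qed.

Lemma rV_unconsK n : cancel (@rV_uncons n) (@rV_cons n).
Proof.
move=> x; apply/rowP => i; rewrite mxE.
by case: (unliftP ord0 i) => [j ->|->] //=; rewrite mxE.
Qed.

Lemma measurable_rV_uncons n : measurable_fun setT (@rV_uncons n).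
Proof.
apply: measurable_fun_pair; first exact: measurable_coord.
apply: measurable_fun_rVP => j; under eq_fun do rewrite mxE.
exact: measurable_coord.
Qed.

Section lebesgue_rV_step.
Context n (mu : {sigma_finite_measure set 'rV[R]_n -> \bar R}).

Definition lebesgue_rV_step : set 'rV[R]_n.+1 -> \bar R :=
  pushforward (@lebesgue_measure R \x mu)%E (@rV_cons n).

Let lebesgue_rV_step0 : lebesgue_rV_step set0 = 0%E.
Proof. by rewrite /lebesgue_rV_step /pushforward preimage_set0 measure0. Qed.

Let lebesgue_rV_step_ge0 A : (0 <= lebesgue_rV_step A)%E.
Proof. exact: (@measure_ge0 _ _ _ (lebesgue_measure \x mu)%E). Qed.

Let lebesgue_rV_step_sigma_additive : semi_sigma_additive lebesgue_rV_step.
Proof.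
exact: (measure_semi_sigma_additive (s := pushforward _ _)).
Qed.

HB.instance Definition _ := isMeasure.Build _ _ _ lebesgue_rV_step
  lebesgue_rV_step0 lebesgue_rV_step_ge0 lebesgue_rV_step_sigma_additive.

Let sigma_finite_lebesgue_rV_step : sigma_finite setT lebesgue_rV_step.
Proof.
have /sigma_finiteP[F [FT ndF Foo]] := sigma_finiteT (@lebesgue_measure R).
have /sigma_finiteP[G [GT ndG Goo]] := sigma_finiteT mu.
exists (fun k => @rV_uncons n @^-1` (F k `*` G k)).
  apply/esym; rewrite -preimage_bigcup -[RHS](@preimage_setT _ _ (@rV_uncons n)).
  congr (_ @^-1` _); apply/seteqP; split => // -[x y] _.
  have [k _ Fkx] : (\bigcup_k F k) x by rewrite -FT.
  have [l _ Gly] : (\bigcup_k G k) y by rewrite -GT.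
  exists (maxn k l) => //; split => /=.
    by move: x Fkx; exact/subsetPset/ndF/leq_maxl.
  by move: y Gly; exact/subsetPset/ndG/leq_maxr.
move=> k; have [mF Fk] := Foo k; have [mG Gk] := Goo k; split.
  rewrite -[X in measurable X]setTI; apply: measurable_rV_uncons => //.
  exact: measurableX.
rewrite /lebesgue_rV_step /pushforward -comp_preimage.
rewrite (_ : @rV_uncons n \o @rV_cons n = id); last first.
  by apply/funext => p /=; rewrite rV_consK.
by rewrite preimage_id product_measure1E// lte_mul_pinfty// ge0_fin_numE.
Qed.

HB.instance Definition _ := Measure_isSigmaFinite.Build _ _ _
  lebesgue_rV_step sigma_finite_lebesgue_rV_step.

End lebesgue_rV_step.

Fixpoint lebesgue_rV n : {sigma_finite_measure set 'rV[R]_n -> \bar R} :=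
  if n is m.+1 then lebesgue_rV_step (lebesgue_rV m)
  else \d_(0 : 'rV[R]_0).

Lemma lebesgue_rV_box n (A : 'I_n -> set R) :
  (forall i, measurable (A i)) ->
  lebesgue_rV n [set x | forall i, A i (x ord0 i)] =
  (\prod_(i < n) (lebesgue_measure (A i) : \bar R))%E.
Proof.
elim: n A => [|n IHn] A mA.
  by rewrite big_ord0 /= diracE mem_set// => -[].
rewrite big_ord_recl /= /lebesgue_rV_step /pushforward.
rewrite -IHn//.
have mB := measurable_rV_box (fun i => mA (lift ord0 i)).
rewrite -(product_measure1E lebesgue_measure (lebesgue_rV n) (mA ord0) mB).
congr (product_measure1 _ _ _); apply/seteqP; split => -[a v] /=.
  move=> h; split; first by have := h ord0; rewrite mxE unlift_none.
  by move=> i; have := h (lift ord0 i); rewrite mxE liftK.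
move=> [h1 h2] i; rewrite mxE.
by case: (unliftP ord0 i) => [j ->|->] //=; exact: h2.
Qed.

End lebesgue_rV.

Section calculus.
Context {R : realType} {n : nat}.
Implicit Types (f u g phi : 'rV[R]_n -> R) (x : 'rV[R]_n).

(* The norm `|x| of the library on 'rV[R]_n is the sup norm. *)
Definition eucl_norm x : R := Num.sqrt (\sum_(i < n) x ord0 i ^+ 2).

Definition partial (i : 'I_n) f : 'rV[R]_n -> R := 'D_(delta_mx ord0 i) f.

Definition gradient f x : 'rV[R]_n := \row_i partial i f x.

(* C^infinity: every iterated partial derivative is Frechet differentiable,
   hence continuous. *)
Definition smooth f : Prop :=
  forall (s : seq 'I_n) x, differentiable (foldr partial f s) x.

Definition compactly_supported f : Prop := compact (closure [set x | f x != 0]).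

Definition is_weak_partial (i : 'I_n) u g : Prop :=
  forall phi, smooth phi -> compactly_supported phi ->
    \int[lebesgue_rV n]_x (u x * partial i phi x) =
    - \int[lebesgue_rV n]_x (g x * phi x).

(* Lfun consists of Borel functions; nothing is lost, since every Lebesgue
   measurable weak derivative has a Borel representative. *)
Definition in_W1 (p : R) u : Prop :=
  u \in Lfun (lebesgue_rV n) p%:E /\
  forall i, exists2 g, g \in Lfun (lebesgue_rV n) p%:E & is_weak_partial i u g.

Definition inf_convolution u (t : R) x : R :=
  inf [set u y + eucl_norm (x - y) ^+ 2 / (2 * t) | y in [set: 'rV[R]_n]].

End calculus.

(* Main.v *)
Require Import Defs.
From mathcomp Require Import all_boot all_order all_algebra.
From mathcomp Require Import all_classical all_reals all_analysis.
From mathcomp Require Import measurable_realfun ring lra.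
Import Order.TTheory GRing.Theory Num.Theory.
Import numFieldNormedType.Exports.
Local Open Scope classical_set_scope.
Local Open Scope ring_scope.

(* Idea. Points have zero n-capacity, so a spike of any prescribed depth and
   arbitrarily small radius can be made of arbitrarily small energy
   int |Du|^n: average N dyadic rescalings of one bump, which yields energy
   O(N^(1-n)). The function u is the sum over k of spikes of depth 8^-k placed
   downwards at the points of the grid of mesh 32^-k, with radius 2^-5 64^-k and
   energies so small that the partial sums converge in W^{1,n}. The points of the
   unit cube that stay at distance at least twice the radius from the centres of
   the spikes of every level form a set of positive measure. At such an x, if K t is
   smaller than the radius of level k, the ball of radius K t around x only meets
   spikes of levels beyond k, where u >= - 8^-k / 4; but if
   n (32^-k)^2 8^k <= t, the nearest spike of level k offers a value below that.
   Hence the minimizer y satisfies |x - y| > K t, and Du_t(x) = (x - y) / t. The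
   ranges of t for consecutive levels overlap as soon as k is large. *)

(** * Integration on row vectors *)

Section integration_on_rV.
Context {R : realType}.
Implicit Types a C : R.

Definition cube n (a : R) : set 'rV[R]_n := [set x | forall i, `|x ord0 i| <= a].
Arguments cube : clear implicits.

Lemma continuous_to_rV (T : topologicalType) n (f : T -> 'rV[R]_n) :
  (forall i, continuous (fun t => f t ord0 i)) -> continuous f.
Proof.
move=> cf t A [P PA PB].
suff : \forall s \near t, forall i, P ord0 i (f s ord0 i).
  apply: filterS => s Ps; apply: PB => i j; rewrite (ord1 i); exact: Ps.
apply: filter_forall => i; exact: (cf i t _ (PA ord0 i)).
Qed.

Lemma continuous_measurable_rV n (f : 'rV[R]_n -> R) :
  continuous f -> measurable_fun setT f.
Proof.
move=> /continuousP cf; apply: (measurability _ (RGenOpens.measurableE R)).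
move=> _ [_ [a [b ->] <-]]; rewrite setTI; apply: measurable_open_rV.
by apply: cf; exact: interval_open.
Qed.

Lemma lebesgue_norm_le (a : R) : 0 <= a ->
  lebesgue_measure [set s : R | `|s| <= a] = (2 * a)%:E.
Proof.
move=> a0; rewrite [X in lebesgue_measure X](_ : _ = `[- a, a]%classic).
  rewrite lebesgue_measure_itv /= lte_fin; case: ifPn => h.
    by rewrite -EFinD opprK; congr EFin; lra.
  by congr EFin; lra.
by apply/seteqP; split => s /=; rewrite in_itv/= ler_norml.
Qed.

Lemma measurable_norm_le (a : R) : measurable [set s : R | `|s| <= a].
Proof.
rewrite [X in measurable X](_ : _ = `[- a, a]%classic)//.
by apply/seteqP; split => s /=; rewrite in_itv/= ler_norml.
Qed.

Lemma measurable_cube n a : measurable (cube n a).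
Proof.
by apply: (@measurable_rV_box R n (fun=> [set s | `|s| <= a])) => i; exact: measurable_norm_le.
Qed.

Lemma lebesgue_cube n a : 0 <= a -> lebesgue_rV n (cube n a) = ((2 * a) ^+ n)%:E.
Proof.
move=> a0; rewrite /cube.
rewrite (@lebesgue_rV_box R n (fun=> [set s | `|s| <= a])); last first.
  by move=> i; exact: measurable_norm_le.
under eq_bigr do rewrite lebesgue_norm_le//.
by rewrite prodEFin prodr_const card_ord.
Qed.

Lemma integrable_bounded_cube n (f : 'rV[R]_n -> R) a C : 0 <= a ->
  measurable_fun setT f -> (forall x, ~ cube n a x -> f x = 0) ->
  (forall x, `|f x| <= C) -> (lebesgue_rV n).-integrable setT (EFin \o f).
Proof.
move=> a0 mf f0 fC.
have := @integrable_mkcond _ _ _ (lebesgue_rV n) (cube n a) (EFin \o f) (measurable_cube n a).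
rewrite (_ : (EFin \o f) \_ (cube n a) = EFin \o f); last first.
  apply/funext => x; rewrite patchE; case: ifPn => //.
  by rewrite notin_setE => /f0 /= ->.
move=> <-; apply: measurable_bounded_integrable => //.
- exact: measurable_cube.
- by have /= -> := lebesgue_cube n a a0; rewrite ltry.
- exact: measurable_funTS.
- exists C; split; first exact: num_real.
  by move=> M CM x _; exact: (le_trans (fC x) (ltW CM)).
Qed.

Lemma compact_cube n a : compact (cube n a).
Proof.
have := @rV_compact R n (fun=> `[- a, a]%classic) (fun=> @segment_compact _ _ _).
congr compact; apply/seteqP; split => x /= xa i; move: (xa i); rewrite in_itv/= ler_norml//.
Qed.

Lemma closed_cube n a : closed (cube n a).
Proof. by apply: compact_closed; [exact: norm_hausdorff|exact: compact_cube]. Qed.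

Lemma continuous_bounded_cube n (f : 'rV[R]_n -> R) a : continuous f ->
  exists2 C : R, 0 <= C & forall x, cube n a x -> `|f x| <= C.
Proof.
move=> cf; have [a0|a0] := pselect (cube n a !=set0); last first.
  by exists 0 => // x xa; exfalso; apply: a0; exists x.
have [c ca cP] : exists2 c, c \in cube n a & forall t, t \in cube n a -> `|f t| <= `|f c|.
  apply: (@EVT_max_rV R n (fun x => `|f x|)) => //; first exact: compact_cube.
  apply: continuous_subspaceT => x.
  by apply: continuous_comp; [exact: cf|exact: norm_continuous].
by exists `|f c| => // x xa; apply: cP; rewrite inE.
Qed.

Lemma integrable_continuous_cube n (f : 'rV[R]_n -> R) a : 0 <= a ->
  continuous f -> (forall x, ~ cube n a x -> f x = 0) ->
  (lebesgue_rV n).-integrable setT (EFin \o f).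
Proof.
move=> a0 cf f0; have [C C0 fC] := continuous_bounded_cube _ _ a cf.
apply: (integrable_bounded_cube _ _ _ C a0) => //.
  exact: continuous_measurable_rV.
by move=> x; have [/fC//|/f0 ->] := pselect (cube n a x); rewrite normr0.
Qed.

Lemma integral_derive_eq0 (F G : R -> R) (a : R) : 0 <= a -> continuous G ->
  (forall s : R, is_derive s (1 : R) F (G s)) ->
  (forall s, a < `|s| -> F s = 0) -> (forall s, a < `|s| -> G s = 0) ->
  (\int[lebesgue_measure]_s (G s)%:E = 0)%E.
Proof.
move=> a0 cG dF F0 G0.
(* The interval reaches beyond [a] because [F] and [G] are only known to vanish where [a < |s|];
   both boundary terms are then 0. *)
have b0 : - (a + 1) < a + 1 by lra.
transitivity (\int[lebesgue_measure]_(s in `[(- (a + 1))%R, (a + 1)%R]) (G s)%:E)%E.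
  rewrite [RHS]integral_mkcond; apply: eq_integral => s _.
  rewrite patchE; case: ifPn => //; rewrite notin_setE /= in_itv/= -ler_norml => /negP.
  by rewrite -ltNge => h; rewrite G0//; lra.
have cF : continuous F.
  by move=> s; apply: differentiable_continuous; apply/derivable1_diffP; exact: ex_derive.
rewrite (@continuous_FTC2 _ G F)//.
- rewrite !F0 ?subee// ?normrN ger0_norm; lra.
- exact: continuous_subspaceT.
- split.
  + by move=> s _; exact: ex_derive.
  + exact/cvg_at_right_filter/cF.
  + exact/cvg_at_left_filter/cF.
- by move=> s _; rewrite derive1E; exact: derive_val.
Qed.

Lemma rV_cons_line n (s : R) (v : 'rV[R]_n) (h : R) :
  h *: delta_mx ord0 ord0 + rV_cons (s, v) = rV_cons (h + s, v).
Proof.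
apply/rowP => i; rewrite !mxE; case: (unliftP ord0 i) => [j ->|->] /=.
  by rewrite mulr0 add0r.
by rewrite mulr1.
Qed.

Lemma rV_cons_lift n (s : R) (v : 'rV[R]_n) (j : 'I_n) (h : R) :
  h *: delta_mx ord0 (lift ord0 j) + rV_cons (s, v) =
  rV_cons (s, h *: delta_mx ord0 j + v).
Proof.
apply/rowP => i; rewrite !mxE; case: (unliftP ord0 i) => [k ->|->] /=.
  by rewrite ?mxE; congr (_ * _ + _); congr ((_ && _)%:R).
by rewrite mulr0 add0r.
Qed.

Lemma continuous_rV_cons n (v : 'rV[R]_n) : continuous (fun s : R => rV_cons (s, v)).
Proof.
apply: continuous_to_rV => i; case: (unliftP ord0 i) => [j ->|->].
  under [X in continuous X]eq_fun do rewrite mxE liftK/=; exact: cst_continuous.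
under [X in continuous X]eq_fun do rewrite mxE unlift_none/=; by move=> x.
Qed.

Lemma continuous_rV_cons2 n (s : R) : continuous (fun v : 'rV[R]_n => rV_cons (s, v)).
Proof.
apply: continuous_to_rV => i; case: (unliftP ord0 i) => [j ->|->].
  under [X in continuous X]eq_fun do rewrite mxE liftK/=; exact: coord_continuous.
under [X in continuous X]eq_fun do rewrite mxE unlift_none/=; exact: cst_continuous.
Qed.

(** Both derivatives are limits of the same difference quotient. The equivalence passes between
    partial derivatives on ['rV[R]_n], derivatives of slices and one-variable calculus. *)
Lemma is_derive_line n (F : 'rV[R]_n -> R) (x v : 'rV[R]_n) (s d : R) :
  is_derive s (1 : R) (fun h => F (h *: v + x)) d <-> is_derive (s *: v + x) v F d.
Proof.
have E : (fun h : R => h^-1 *: (((fun h => F (h *: v + x)) \o shift s) (h *: (1 : R))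
    - F (s *: v + x))) =
  (fun h : R => h^-1 *: ((F \o shift (s *: v + x)) (h *: v) - F (s *: v + x))).
  apply/funext => h /=; congr (_ *: (F _ - _)).
  by rewrite (_ : h *: (1 : R) = h) ?scalerDl ?addrA//; exact: mulr1.
split => -[]; rewrite /derivable /derive/=.
  by rewrite E => h1 h2; constructor.
by rewrite -E => h1 h2; constructor.
Qed.

(** Integration by parts without boundary term. The induction follows the recursive product
    structure of [lebesgue_rV]. By Fubini, either [i] is a later coordinate and the slices with
    fixed first coordinate fall under the induction hypothesis, or [i] is the first one and the
    inner integral vanishes by the fundamental theorem of calculus. *)
Lemma integral_partial_eq0 n (i : 'I_n) (F G : 'rV[R]_n -> R) (a : R) :
  0 <= a -> continuous G ->
  (forall x : 'rV[R]_n, is_derive x (delta_mx ord0 i) F (G x)) ->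
  (forall x, ~ cube n a x -> F x = 0) -> (forall x, ~ cube n a x -> G x = 0) ->
  (\int[lebesgue_rV n]_x (G x)%:E = 0)%E.
Proof.
elim: n i F G => [[]//|n IHn] i F G a0 cG dF F0 G0.
have iG := integrable_continuous_cube _ _ _ a0 cG G0.
have mG : measurable_fun setT (EFin \o G) by have /integrableP[] := iG.
have iGc : (lebesgue_measure \x lebesgue_rV n)%E.-integrable setT
    ((EFin \o G) \o @rV_cons R n).
  move/integrableP : (iG) => [_ jG]; apply/integrableP; split.
    by apply: measurableT_comp => //; exact: measurable_rV_cons.
  move: jG; rewrite /= ge0_integral_pushforward//.
  apply/measurable_EFinP.
  apply: continuous_measurable_rV => x.
  by apply: continuous_comp; [exact: cG|exact: norm_continuous].
rewrite /= integral_pushforward//.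
rewrite preimage_setT.
case: (unliftP ord0 i) => [j ij|i0].
  rewrite -(integral12_prod_meas1 iGc) /fubini_F/=.
  apply: integral0_eq => s _.
  apply: (IHn j (fun v => F (rV_cons (s, v))) (fun v => G (rV_cons (s, v))) a0).
  - by move=> v; apply: continuous_comp; [exact: continuous_rV_cons2|exact: cG].
  - move=> v; have := (is_derive_line _ F (rV_cons (s, v)) (delta_mx ord0 i) 0
      (G (rV_cons (s, v)))).2.
    rewrite scale0r add0r => /(_ (dF _)).
    rewrite (_ : (fun h => F (h *: delta_mx ord0 i + rV_cons (s, v))) =
      (fun h => F (rV_cons (s, h *: delta_mx ord0 j + v)))); last first.
      by apply/funext => h; rewrite ij rV_cons_lift.
    by move/(is_derive_line _ (fun v => F (rV_cons (s, v)))); rewrite scale0r add0r.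
  - move=> v va; apply: F0 => h; apply: va => k.
    by have := h (lift ord0 k); rewrite mxE liftK.
  - move=> v va; apply: G0 => h; apply: va => k.
    by have := h (lift ord0 k); rewrite mxE liftK.
rewrite -(integral21_prod_meas1 iGc) /fubini_G/=.
apply: integral0_eq => v _.
apply: (integral_derive_eq0 (fun s => F (rV_cons (s, v))) (fun s => G (rV_cons (s, v))) _ a0).
- by move=> s; apply: continuous_comp; [exact: continuous_rV_cons|exact: cG].
- move=> s; have := (is_derive_line _ F (rV_cons (0, v)) (delta_mx ord0 ord0) s
    (G (rV_cons (s, v)))).2.
  rewrite (_ : (fun h => F (h *: delta_mx ord0 ord0 + rV_cons (0, v))) =
    (fun h => F (rV_cons (h, v)))); last first.
    by apply/funext => h; rewrite rV_cons_line addr0.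
  by rewrite rV_cons_line addr0 -i0; apply; exact: dF.
- move=> s sa; apply: F0 => /(_ ord0); rewrite mxE unlift_none/=.
  by rewrite leNgt sa.
- move=> s sa; apply: G0 => /(_ ord0); rewrite mxE unlift_none/=.
  by rewrite leNgt sa.
Qed.

End integration_on_rV.

(** * Series dominated by a geometric series *)

Section geometric_domination.
Context {R : realType}.
Implicit Types (b : R^nat) (B : R).

(** The right-hand side is the exact sum of [B * 2^-1 ^+ k] over [N <= k < M]; in this form the
    induction on [M] closes. *)
Lemma series_geometric_tail b B : (forall k, `|b k| <= B * 2^-1 ^+ k) ->
  forall N M, (N <= M)%N ->
    `|series b M - series b N| <= 2 * B * 2^-1 ^+ N - 2 * B * 2^-1 ^+ M.
Proof.
move=> bB N; elim=> [|M IH]; first by rewrite leqn0 => /eqP->; rewrite !subrr normr0.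
rewrite leq_eqVlt => /predU1P[->|]; first by rewrite !subrr normr0.
rewrite ltnS => /IH {}IH; rewrite seriesSr addrAC.
apply: (le_trans (ler_normD _ _)); apply: (le_trans (lerD IH (bB M))).
by rewrite [X in _ <= _ - X](_ : _ = B * 2^-1 ^+ M); [lra|rewrite exprS; field].
Qed.

Lemma series_geometric_cvg b B : (forall k, `|b k| <= B * 2^-1 ^+ k) -> cvgn (series b).
Proof.
move=> bB; apply: normed_cvg.
have B0 : 0 <= B by have := bB 0%N; rewrite expr0 mulr1; apply: le_trans.
apply: (@series_le_cvg _ _ (geometric B 2^-1)) => //= [k|].
- by rewrite mulr_ge0// exprn_ge0// invr_ge0.
- by apply: is_cvg_geometric_series; rewrite ger0_norm ?invr_ge0// invf_lt1 ?ltr1n.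
Qed.

Lemma lim_series_geometric b B : (forall k, `|b k| <= B * 2^-1 ^+ k) ->
  forall N, `|limn (series b) - series b N| <= 2 * B * 2^-1 ^+ N.
Proof.
move=> bB N; have B0 : 0 <= B by have := bB 0%N; rewrite expr0 mulr1; apply: le_trans.
have cb := series_geometric_cvg _ _ bB.
apply: (cvgr_to_le (F := \oo) (f := fun M => `|series b M - series b N|)).
  by apply: cvg_norm; apply: cvgB; [exact: cb|exact: cvg_cst].
near=> M.
apply: (le_trans (series_geometric_tail _ _ bB N M _)); first by near: M; exact: nbhs_infty_ge.
by rewrite gerBl// !mulr_ge0// exprn_ge0// invr_ge0.
Unshelve. all: by end_near. Qed.

Lemma lim_series_geometric_le b B : (forall k, `|b k| <= B * 2^-1 ^+ k) ->
  `|limn (series b)| <= 2 * B.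
Proof.
move=> /lim_series_geometric /(_ 0%N); rewrite expr0 mulr1.
by rewrite seriesEnat/= big_geq// subr0.
Qed.

Lemma series_geometric_le b B : (forall k, `|b k| <= B * 2^-1 ^+ k) ->
  forall N, `|series b N| <= 2 * B.
Proof.
move=> bB N; have B0 : 0 <= B by have := bB 0%N; rewrite expr0 mulr1; apply: le_trans.
have := series_geometric_tail _ _ bB 0 N (leq0n _); rewrite expr0 mulr1.
rewrite (_ : series b 0 = 0) ?subr0; last by rewrite seriesEnat/= big_geq.
move=> /le_trans; apply.
by rewrite gerBl// !mulr_ge0// exprn_ge0// invr_ge0.
Qed.

Lemma continuous_series (T : topologicalType) (v : nat -> T -> R) N :
  (forall k, continuous (v k)) -> continuous (fun x => series (v ^~ x) N).
Proof.
move=> cv; elim: N => [|N IH] x.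
  rewrite (_ : (fun x => _) = cst 0); first exact: cvg_cst.
  by apply/funext => y; rewrite seriesEnat/= big_geq.
rewrite (_ : (fun x => _) = (fun x => series (v ^~ x) N + v N x)).
  by apply: cvgD; [exact: IH|exact: cv].
by apply/funext => y; rewrite seriesSr.
Qed.

(** Weierstrass test: the tail bound is uniform in the point, so one continuous partial sum is
    within [e / 3] of the limit everywhere. *)
Lemma continuous_series_geometric (T : topologicalType) (v : nat -> T -> R) B :
  (forall k, continuous (v k)) -> (forall k x, `|v k x| <= B * 2^-1 ^+ k) ->
  continuous (fun x => limn (series (v ^~ x))).
Proof.
move=> cv vB x.
have B0 : 0 <= B by have := vB 0%N x; rewrite expr0 mulr1; apply: le_trans.
apply/cvgrPdist_le => e e0.
have [N Ne] : exists N, 2 * B * 2^-1 ^+ N <= e / 3.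
  have : (geometric (2 * B) 2^-1) @ \oo --> (0 : R).
    by apply: cvg_geometric; rewrite ger0_norm ?invr_ge0// invf_lt1 ?ltr1n.
  move/cvgrPdist_le => /(_ (e / 3)); rewrite divr_gt0// => /(_ isT)[N _ /(_ N (leqnn N))].
  rewrite /= sub0r normrN ger0_norm; first by exists N.
  by rewrite !mulr_ge0// exprn_ge0// invr_ge0.
have cS := continuous_series _ v N cv.
have /cvgrPdist_le/(_ (e / 3)) := cS x; rewrite divr_gt0// => /(_ isT).
apply: filterS => y xy.
rewrite (_ : _ - _ = (limn (series (v ^~ x)) - series (v ^~ x) N) +
  (series (v ^~ x) N - series (v ^~ y) N) -
  (limn (series (v ^~ y)) - series (v ^~ y) N)); last by ring.
have hx := lim_series_geometric _ _ (vB ^~ x) N.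
have hy := lim_series_geometric _ _ (vB ^~ y) N.
apply: (le_trans (ler_normB _ _)).
have := ler_normD (limn (series (v ^~ x)) - series (v ^~ x) N)
  (series (v ^~ x) N - series (v ^~ y) N).
move: xy Ne hx hy; lra.
Qed.

End geometric_domination.

(** * Weak derivatives of series *)

Section weak_derivative_of_series.
Context {R : realType}.

Lemma Lfun_natP n p (f : 'rV[R]_n -> R) : (0 < p)%N -> measurable_fun setT f ->
  (\int[lebesgue_rV n]_x (`|f x| ^+ p)%:E < +oo)%E ->
  f \in Lfun (lebesgue_rV n) (p%:R)%:E.
Proof.
move=> p0 mf fp; rewrite inE/=; apply/andP; split; rewrite inE/=; first exact: mf.
rewrite /finite_norm unlock /Lnorm poweR_lty//.
by under eq_integral do rewrite poweR_EFin powR_mulrn//.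
Qed.

(** The weights [2 ^+ k] let this single function control the whole series: where it is finite, the
    terms [d k x] are dominated by a geometric series whose constant is its [n]-th root. It takes
    the place of an appeal to the completeness of L^n. *)
Definition energy_density n (d : nat -> 'rV[R]_n -> R) (x : 'rV[R]_n) : \bar R :=
  (\sum_(0 <= k <oo) ((2 ^+ k * `|d k x|) ^+ n)%:E)%E.

Lemma energy_density_ge0 n (d : nat -> 'rV[R]_n -> R) x : (0 <= energy_density n d x)%E.
Proof. by apply: nneseries_ge0 => k _ _; rewrite lee_fin exprn_ge0// mulr_ge0// exprn_ge0. Qed.

Lemma measurable_energy_density n (d : nat -> 'rV[R]_n -> R) :
  (forall k, continuous (d k)) -> measurable_fun setT (energy_density n d).
Proof.
move=> cd; apply: (@ge0_emeasurable_sum _ _ _ _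
  (fun k x => ((2 ^+ k * `|d k x|) ^+ n)%:E) xpredT) => [k x _ _|k _].
  by rewrite lee_fin exprn_ge0// mulr_ge0// exprn_ge0.
apply/measurable_EFinP; apply: measurable_funX; apply: measurable_funM => //.
by apply: measurableT_comp => //; exact: continuous_measurable_rV.
Qed.

Lemma energy_density_bound n (d : nat -> 'rV[R]_n -> R) x : (0 < n)%N ->
  energy_density n d x \is a fin_num ->
  exists B : R, [/\ 0 <= B, B ^+ n = fine (energy_density n d x) &
    forall k, `|d k x| <= B * 2^-1 ^+ k].
Proof.
move=> n0 Qf; have Q0 := energy_density_ge0 n d x.
pose B := fine (energy_density n d x) `^ n%:R^-1.
have BE : B ^+ n = fine (energy_density n d x).
  rewrite /B -powR_mulrn ?powR_ge0// -powRrM mulVf ?pnatr_eq0 -?lt0n// powRr1//.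
  exact: fine_ge0.
exists B; split => [|//|]; first exact: powR_ge0.
move=> k; rewrite exprVn ler_pdivlMr ?exprn_gt0// mulrC.
rewrite -(@ler_pXn2r _ n)// ?nnegrE ?powR_ge0// ?mulr_ge0// ?exprn_ge0//.
rewrite BE -lee_fin fineK//.
have h j : (0 <= ((2 ^+ j * `|d j x|) ^+ n)%:E)%E.
    by rewrite lee_fin exprn_ge0// mulr_ge0// exprn_ge0.
apply: (le_trans _ (@nneseries_lim_ge _ (fun j => ((2 ^+ j * `|d j x|) ^+ n)%:E)
  xpredT 0 k.+1 _)) => //.
by rewrite big_nat_recr//= leeDr// sume_ge0.
Qed.

Lemma integral_energy_density n (d : nat -> 'rV[R]_n -> R) : (0 < n)%N ->
  (forall k, continuous (d k)) ->
  (forall k, (\int[lebesgue_rV n]_x (`|d k x| ^+ n)%:E <= ((4^-1 ^+ k) ^+ n)%:E)%E) ->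
  (\int[lebesgue_rV n]_x energy_density n d x <= 2%:E)%E.
Proof.
move=> n0 cd dI; rewrite integral_nneseries//; last first.
  move=> k; apply/measurable_EFinP; apply: measurable_funX; apply: measurable_funM => //.
  by apply: measurableT_comp => //; exact: continuous_measurable_rV.
apply: (@le_trans _ _ (\sum_(0 <= k <oo) (2^-1 ^+ k)%:E)%E); last first.
  apply: lime_le.
    by apply: is_cvg_nneseries => k _ _; rewrite lee_fin exprn_ge0// invr_ge0.
  near=> N; rewrite sumEFin lee_fin.
  have := @series_geometric_le R (fun k => 2^-1 ^+ k) 1 _ N.
  rewrite mulr1 seriesEnat/= ger0_norm; last first.
    by apply: sumr_ge0 => k _; rewrite exprn_ge0// invr_ge0.
  by apply => k; rewrite mul1r ger0_norm// exprn_ge0// invr_ge0.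
apply: lee_nneseries => [k _ _|k _].
  by apply: integral_ge0 => x _; rewrite lee_fin exprn_ge0// mulr_ge0// exprn_ge0.
under eq_integral => x _ do rewrite exprMn EFinM.
rewrite ge0_integralZl_EFin ?exprn_ge0//; last first.
  apply/measurable_EFinP; apply: measurable_funX.
  by apply: measurableT_comp => //; exact: continuous_measurable_rV.
apply: (le_trans (lee_wpmul2l _ (dI k))); first by rewrite lee_fin !exprn_ge0.
(* The weight costs [2 ^+ k] against [4^-1 ^+ k], leaving [2^-1 ^+ k] to the power [n], which is at
   most [2^-1 ^+ k] since [n >= 1]. *)
rewrite -EFinM lee_fin -exprMn -exprMn (_ : 2 * 4^-1 = 2^-1 :> R); last by field.
rewrite -[leRHS]expr1 ler_wiXn2l// ?exprn_ge0// ?invr_ge0// exprn_ile1 ?invr_ge0//.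
by rewrite invf_le1 ?ler1n.
Unshelve. all: by end_near. Qed.

Lemma is_derive_series n (v d : nat -> 'rV[R]_n -> R) (x e : 'rV[R]_n) N :
  (forall k, is_derive x e (v k) (d k x)) ->
  is_derive x e (fun y => series (v ^~ y) N) (series (d ^~ x) N).
Proof.
move=> vd; have := @is_derive_sum R _ _ N (fun k => v k) x e (fun k => d k x) (fun k => vd k).
rewrite (_ : (fun y => _) = \sum_(k < N) v k) ?seriesEord//.
by apply/funext => y; rewrite seriesEord/= fct_sumE.
Qed.

(** The weak derivative is the pointwise sum of the classical ones, which converges almost
    everywhere because the energy density is integrable. Partial sums satisfy the integration by
    parts formula exactly, and dominated convergence passes to the limit. *)
Lemma weak_partial_series n (i : 'I_n) (a : R) (v d : nat -> 'rV[R]_n -> R) :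
  0 <= a ->
  (forall k, continuous (v k)) -> (forall k, continuous (d k)) ->
  (forall k x, `|v k x| <= 2^-1 ^+ k) ->
  (forall k x, ~ cube n a x -> v k x = 0) ->
  (forall k x, ~ cube n a x -> d k x = 0) ->
  (forall k (x : 'rV[R]_n), is_derive x (delta_mx ord0 i) (v k) (d k x)) ->
  (forall k, (\int[lebesgue_rV n]_x (`|d k x| ^+ n)%:E <= ((4^-1 ^+ k) ^+ n)%:E)%E) ->
  exists2 g, g \in Lfun (lebesgue_rV n) (n%:R)%:E &
    is_weak_partial i (fun x => limn (series (v ^~ x))) g.
Proof.
move=> a0 cv cd vB v0 d0 vd dI.
have n0 : (0 < n)%N by rewrite (leq_trans _ (ltn_ord i)).
pose Q := energy_density n d.
have Q0 x : (0 <= Q x)%E by exact: energy_density_ge0.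
have mQ : measurable_fun setT Q by exact: measurable_energy_density.
have IQ : (\int[lebesgue_rV n]_x Q x < +oo)%E.
  by rewrite (le_lt_trans (integral_energy_density _ _ n0 cd dI))// ltry.
have iQ : (lebesgue_rV n).-integrable setT Q.
  apply/integrableP; split => //.
  by under eq_integral do rewrite gee0_abs//.
have fineQ x : ((fine (Q x))%:E <= Q x)%E.
  by have := Q0 x; case: (Q x) => //= _; rewrite leey.
pose Z := [set x | Q x \is a fin_num].
have mZ : measurable Z.
  by rewrite -[Z]setTI; exact: emeasurable_fin_num.
(* Cutting the terms off outside [Z] makes the series converge at every point, so that its sum [g]
   is measurable as a pointwise limit. *)
pose w k x := d k x * \1_Z x.
have wB x : exists B, [/\ 0 <= B, B ^+ n = fine (Q x) & forall k, `|w k x| <= B * 2^-1 ^+ k].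
  have [Zx|Zx] := boolP (Q x \is a fin_num).
    have [B [B0 BQ dB]] := energy_density_bound _ _ _ n0 Zx.
    exists B; split => // k; rewrite /w indicE mem_set//= mulr1; exact: dB.
  (* Outside [Z] the density is infinite, [fine] returns the default value 0, and [B = 0] agrees
     with it because [n > 0]. *)
  exists 0; split => //.
    by move: Zx (Q0 x); case: (Q x) => //= _ _; rewrite expr0n eqn0Ngt n0.
  by move=> k; rewrite /w indicE memNset ?mulr0 ?normr0 ?mul0r//; exact/negP.
pose u x := limn (series (v ^~ x)).
pose g x := limn (series (w ^~ x)).
have wg x : series (w ^~ x) @ \oo --> g x.
  by have [B [_ _ wx]] := wB x; exact: series_geometric_cvg wx.
have vB' x k : `|v k x| <= 1 * 2^-1 ^+ k by rewrite mul1r.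
have vu x : series (v ^~ x) @ \oo --> u x by exact: series_geometric_cvg (vB' x).
have cu : continuous u.
  by apply: (@continuous_series_geometric _ _ _ 1) => // k x; exact: vB'.
have mg : measurable_fun setT g.
  apply/measurable_EFinP.
  apply: (emeasurable_fun_cvg (fun N x => (series (w ^~ x) N)%:E)).
    move=> N; apply/measurable_EFinP.
    under eq_fun do rewrite seriesEnat/=.
    apply: measurable_sum => k; apply: measurable_funM.
      exact: continuous_measurable_rV.
    exact: measurable_indic.
  move=> x _; apply: cvg_EFin; first by near=> N.
  exact: wg.
have gB x : `|g x| ^+ n <= 2 ^+ n * fine (Q x).
  have [B [B0 <- wx]] := wB x; rewrite -exprMn lerXn2r// ?nnegrE ?mulr_ge0//.
  exact: lim_series_geometric_le.
exists g.
  apply: Lfun_natP => //.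
  apply: (@le_lt_trans _ _ (\int[lebesgue_rV n]_x ((2 ^+ n)%:E * Q x))%E).
    apply: ge0_le_integral => //.
    - by apply/measurable_EFinP; apply: measurable_funX; exact: measurableT_comp.
    - exact: measurable_funeM.
    - move=> x _; apply: (@le_trans _ _ (2 ^+ n * fine (Q x))%:E); first by rewrite lee_fin.
      by rewrite EFinM lee_wpmul2l// lee_fin exprn_ge0.
  by rewrite ge0_integralZl_EFin// ?exprn_ge0// lte_mul_pinfty// lee_fin exprn_ge0.
move=> phi sphi _; rewrite -/u.
have cphi : continuous phi.
  by move=> x; apply: differentiable_continuous; exact: (sphi [::]).
have cdphi : continuous (partial i phi).
  by move=> x; apply: differentiable_continuous; exact: (sphi [:: i]).
have [C1 C10 phiC] := continuous_bounded_cube _ _ a cphi.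
have [C2 C20 dphiC] := continuous_bounded_cube _ _ a cdphi.
(* [F N] is the partial derivative of the product of the [N]-th partial sum with [phi], so its
   integral vanishes; [f] is its almost everywhere limit. *)
pose F N x := series (v ^~ x) N * partial i phi x + series (d ^~ x) N * phi x.
pose f x := u x * partial i phi x + g x * phi x.
have s0 (b : nat -> R) N : (forall k, b k = 0) -> series b N = 0.
  by move=> b0; rewrite seriesEnat/= big1.
have u0 x : ~ cube n a x -> u x = 0.
  move=> xa; rewrite /u (_ : series _ = cst 0) ?lim_cst//.
  by apply/funext => N; rewrite s0// => k; exact: v0.
have cF N : continuous (F N).
  have c1 := continuous_series _ v N cv; have c2 := continuous_series _ d N cd.
  by move=> x; exact: (cvgD (cvgM (c1 x) (cdphi x)) (cvgM (c2 x) (cphi x))).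
have IF N : (\int[lebesgue_rV n]_x (F N x)%:E = 0)%E.
  apply: (integral_partial_eq0 _ i (fun x => series (v ^~ x) N * phi x) (F N) a) => //.
  - move=> x.
    have D1 := is_derive_series _ v d x (delta_mx ord0 i) N (vd ^~ x).
    have D2 : is_derive x (delta_mx ord0 i) phi (partial i phi x).
      by apply: DeriveDef => //; apply: diff_derivable; exact: (sphi [::]).
    have := is_deriveM D1 D2; congr is_derive.
    by rewrite /F /GRing.scale/=; ring.
  - by move=> x xa; rewrite s0 ?mul0r// => k; exact: v0.
  - by move=> x xa; rewrite /F !s0 ?mul0r ?addr0// => k; [exact: d0|exact: v0].
pose C := 2 * C1 + 2 * C2.
(* The dominating function: on the cube, [F N] is bounded by [2 * C2 + 2 * B * C1], where [B ^+ n]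
   is the energy density, and [B <= 1 + B ^+ n]. *)
pose h x : \bar R := (C%:E * ((\1_(cube n a) x)%:E + Q x))%E.
have C0 : 0 <= C by rewrite addr_ge0// mulr_ge0.
have ih : (lebesgue_rV n).-integrable setT h.
  apply: integrableZl => //; apply: integrableD => //.
  apply: (integrable_bounded_cube _ _ a 1) => //.
  - by apply: measurable_indic; exact: measurable_cube.
  - by move=> x xa; rewrite indicE memNset.
  - by move=> x; rewrite indicE ger0_norm// lern1 leq_b1.
have [if_ _ cvgF] : [/\ (lebesgue_rV n).-integrable setT (EFin \o f),
    [sequence \int[lebesgue_rV n]_(x in setT) `|(F N x)%:E - (f x)%:E|]_N @ \oo --> 0%E &
    [sequence \int[lebesgue_rV n]_(x in setT) (F N x)%:E]_N @ \oo -->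
      (\int[lebesgue_rV n]_(x in setT) (f x)%:E)%E]%E.
  apply: (@dominated_convergence _ _ _ (lebesgue_rV n) setT measurableT
    (fun N x => (F N x)%:E) (EFin \o f) h) => //.
  - by move=> N; apply/measurable_EFinP; exact: continuous_measurable_rV.
  - apply/measurable_EFinP; apply: measurable_funD; apply: measurable_funM => //;
      exact: continuous_measurable_rV.
  - have := integrable_ae measurableT iQ; apply: filterS => x /(_ I) Zx _.
    apply: cvg_EFin; first by near=> N.
    apply: cvgD; apply: cvgM; [exact: vu|exact: cvg_cst| |exact: cvg_cst].
    rewrite (_ : series (d ^~ x) = series (w ^~ x))//; congr series.
    by apply/funext => k; rewrite /w indicE mem_set ?mulr1.
  - have := integrable_ae measurableT iQ; apply: filterS => x /(_ I) Zx N _.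
    rewrite /h -(fineK Zx) indicE.
    have [xa|xa] := pselect (cube n a x); last first.
      rewrite /F !s0 ?mul0r ?addr0 => [|k|k]; [|exact: d0|exact: v0].
      by rewrite memNset// abse0 add0e mule_ge0// ?lee_fin// fine_ge0.
    rewrite mem_set//= lee_fin.
    have [B [B0 BQ dB]] := energy_density_bound _ _ _ n0 Zx.
    have := series_geometric_le _ _ dB N; have := series_geometric_le _ _ (vB' x) N.
    rewrite mulr1 -BQ => vN dN.
    have Bn : B <= 1 + B ^+ n.
      have [B1|B1] := leP B 1; first by rewrite (le_trans B1)// lerDl exprn_ge0.
      by rewrite (@le_trans _ _ (B ^+ n))// ?ler_eXnr ?lerDr// ltW.
    apply: (le_trans (ler_normD _ _)); rewrite !normrM.
    apply: (@le_trans _ _ (2 * C2 + 2 * (1 + B ^+ n) * C1)).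
      apply: lerD; first by rewrite ler_pM// dphiC.
      rewrite ler_pM// ?phiC//; apply: (le_trans dN); rewrite ler_pM2l//.
    have := exprn_ge0 n B0; rewrite /C; nra.
have If0 : (\int[lebesgue_rV n]_x (f x)%:E = 0)%E.
  apply: (cvg_unique _ cvgF) => //.
  rewrite (_ : (fun N => _) = cst 0%E); first exact: cvg_cst.
  by apply/funext => N; exact: IF.
have iu : (lebesgue_rV n).-integrable setT (EFin \o (fun x => u x * partial i phi x)).
  apply: (integrable_continuous_cube _ _ a) => //.
    by move=> x; exact: (cvgM (cu x) (cdphi x)).
  by move=> x xa; rewrite u0 ?mul0r.
(* Integrability of this half comes by subtracting the continuous half from [f]; both are required
   to split the vanishing integral of [f]. *)
have ig : (lebesgue_rV n).-integrable setT (EFin \o (fun x => g x * phi x)).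
  have := integrableB measurableT if_ iu.
  by apply: eq_integrable => // x _ /=; rewrite -EFinB /f addrAC subrr add0r.
apply/eqP; rewrite -addr_eq0 -RintegralD//; apply/eqP.
by rewrite /Rintegral If0.
Unshelve. all: by end_near. Qed.

Lemma compactly_supported_cube n (a : R) (u : 'rV[R]_n -> R) :
  (forall x, ~ cube n a x -> u x = 0) -> compactly_supported u.
Proof.
move=> u0; apply: (subclosed_compact _ (compact_cube n a)).
  exact: closed_closure.
rewrite (closure_id (cube n a)).1; last exact: closed_cube.
apply: closureS => x /= ux; apply: contrapT => xa.
by move: ux; rewrite u0// eqxx.
Qed.

Lemma in_W1_series n (a : R) (v : nat -> 'rV[R]_n -> R)
    (d : nat -> 'I_n -> 'rV[R]_n -> R) : (0 < n)%N -> 0 <= a ->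
  (forall k, continuous (v k)) -> (forall k i, continuous (d k i)) ->
  (forall k x, `|v k x| <= 2^-1 ^+ k) ->
  (forall k x, ~ cube n a x -> v k x = 0) ->
  (forall k i x, ~ cube n a x -> d k i x = 0) ->
  (forall k i (x : 'rV[R]_n), is_derive x (delta_mx ord0 i) (v k) (d k i x)) ->
  (forall k i, (\int[lebesgue_rV n]_x (`|d k i x| ^+ n)%:E <= ((4^-1 ^+ k) ^+ n)%:E)%E) ->
  let u := fun x => limn (series (v ^~ x)) in
  [/\ continuous u, compactly_supported u & in_W1 n%:R u].
Proof.
move=> n0 a0 cv cd vB v0 d0 vd dI u.
have cu : continuous u.
  by apply: (@continuous_series_geometric _ _ _ 1) => // k x; rewrite mul1r.
have u0 x : ~ cube n a x -> u x = 0.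
  move=> xa; rewrite /u (_ : series _ = cst 0) ?lim_cst//.
  by apply/funext => N; rewrite seriesEnat/= big1// => k _; exact: v0.
split => //; first exact: compactly_supported_cube u0.
split; last first.
  move=> i; exact: (weak_partial_series _ i a v (d ^~ i) a0 cv (cd ^~ i) vB v0
    (d0 ^~ i) (vd ^~ i) (dI ^~ i)).
apply: Lfun_natP => //; first exact: continuous_measurable_rV.
have : (lebesgue_rV n).-integrable setT (EFin \o (fun x => `|u x| ^+ n)).
  apply: (integrable_continuous_cube _ _ a) => //; last first.
    by move=> x /u0 ->; rewrite normr0 expr0n eqn0Ngt n0.
  move=> x; apply: (continuous_comp (f := u) (g := fun s : R => `|s| ^+ n)); first exact: cu.
  apply: (continuous_comp (f := fun s : R => `|s|) (g := fun s : R => s ^+ n)).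
    exact: norm_continuous.
  exact: exprn_continuous.
move=> /integrableP[_].
by under eq_integral do rewrite /= ger0_norm ?exprn_ge0//.
Qed.

End weak_derivative_of_series.

(** * The gradient of the infimal convolution *)

Section gradient_of_inf_convolution.
Context {R : realType}.
Implicit Types t M : R.

Lemma eucl_norm_ge0 n (x : 'rV[R]_n) : 0 <= eucl_norm x.
Proof. exact: sqrtr_ge0. Qed.

Lemma sqr_eucl_norm n (x : 'rV[R]_n) : eucl_norm x ^+ 2 = \sum_(i < n) x ord0 i ^+ 2.
Proof. by rewrite sqr_sqrtr// sumr_ge0// => i _; exact: sqr_ge0. Qed.

Lemma coord_le_eucl_norm n (x : 'rV[R]_n) i : `|x ord0 i| <= eucl_norm x.
Proof.
rewrite -(@ler_pXn2r _ 2)// ?nnegrE ?eucl_norm_ge0// sqr_eucl_norm real_normK ?num_real//.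
by rewrite (bigD1 i)//= lerDl sumr_ge0// => j _; exact: sqr_ge0.
Qed.

Lemma coord_le_norm n (x : 'rV[R]_n) i : `|x ord0 i| <= `|x|.
Proof.
rewrite [`|x|]mx_normrE; exact: (le_bigmax _ (fun ij => `|x ij.1 ij.2|) (ord0, i)).
Qed.

Lemma eucl_normZ n (c : R) (x : 'rV[R]_n) : 0 <= c -> eucl_norm (c *: x) = c * eucl_norm x.
Proof.
move=> c0; apply: (@pexpIrn _ 2) => //; rewrite ?nnegrE ?mulr_ge0 ?eucl_norm_ge0//.
by rewrite exprMn !sqr_eucl_norm mulr_sumr; apply: eq_bigr => i _; rewrite mxE exprMn.
Qed.

(** A parabola touching the graph from above at 0 fixes the slope: quotients at [h > 0] give
    [D <= c], quotients at [- h] give [D >= c], up to errors of order [h]. *)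
Lemma slope_eq_quadratic_majorant (f : R -> R) (D c C : R) :
  (fun h => h^-1 * (f h - f 0)) @ 0^' --> D ->
  (forall h, f h <= f 0 + c * h + C * h ^+ 2) -> D = c.
Proof.
move=> fD fc.
have near0 e : 0 < e -> exists h, [/\ 0 < h, `|C| * h < e,
    `|D - h^-1 * (f h - f 0)| < e & `|D - (- h)^-1 * (f (- h) - f 0)| < e].
  move=> e0; have /cvgrPdist_lt/(_ _ e0) := fD.
  move=> /nbhs_ballP[d /= d0 dP].
  (* Small enough for [h] and [- h] to lie in the ball of radius [d] and for [|C| * h] to stay below
     [e]; the [+ 1] covers [C = 0]. *)
  pose h := Num.min (d / 2) (e / 2 / (`|C| + 1)).
  have h0 : 0 < h by rewrite lt_min !divr_gt0// ltr_wpDl.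
  have hd : h < d by rewrite gt_min; apply/orP; left; lra.
  have he : h * (`|C| + 1) <= e / 2.
    by rewrite -ler_pdivlMr ?ltr_wpDl// ge_min lexx orbT.
  exists h; split => //.
  - have := normr_ge0 C; nra.
  - apply: dP; last exact: lt0r_neq0.
    by rewrite /ball/= sub0r normrN gtr0_norm.
  - apply: dP; last by rewrite oppr_eq0 lt0r_neq0.
    by rewrite /ball/= sub0r opprK gtr0_norm.
apply/le_anti/andP; split; apply/ler_addgt0Pr => e e0.
  have [|h [h0 hC + _]] := near0 (e / 2); first by rewrite divr_gt0.
  have : h^-1 * (f h - f 0) <= c + C * h.
    by rewrite ler_pdivrMl// lerBlDl (le_trans (fc h))// -addrA lerD2l; lra.
  rewrite ltr_norml => + /andP[]; have := ler_norm C; nra.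
have [|h [h0 hC _ +]] := near0 (e / 2); first by rewrite divr_gt0.
have : c - C * h <= (- h)^-1 * (f (- h) - f 0).
  rewrite invrN mulNr lerNr opprB ler_pdivrMl// lerBlDl (le_trans (fc (- h)))//.
  by rewrite -addrA lerD2l sqrrN; lra.
rewrite ltr_norml => + /andP[]; have := ler_norm C; nra.
Qed.

(** Envelope argument: with the minimizer [y] frozen, the value at [y] is a quadratic function of
    the base point which lies above the infimal convolution and touches it at [x]. Along each
    coordinate this determines the derivative. *)
Lemma gradient_inf_convolution n (u : 'rV[R]_n -> R) t M (x y : 'rV[R]_n) :
  0 < t -> (forall z, - M <= u z) ->
  (forall z, u y + eucl_norm (x - y) ^+ 2 / (2 * t) <= u z + eucl_norm (x - z) ^+ 2 / (2 * t)) ->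
  differentiable (inf_convolution u t) x ->
  gradient (inf_convolution u t) x = t^-1 *: (x - y).
Proof.
move=> t0 uM ymin dw; set w := inf_convolution u t.
have q0 (v : 'rV[R]_n) : 0 <= eucl_norm v ^+ 2 / (2 * t).
  by rewrite divr_ge0 ?exprn_ge0 ?eucl_norm_ge0// mulr_ge0// ltW.
have wub z v : w z <= u v + eucl_norm (z - v) ^+ 2 / (2 * t).
  apply: ge_inf; last by exists v.
  by exists (- M) => _ [v' _ <-]; rewrite -[leLHS]addr0 lerD.
have wx : w x = u y + eucl_norm (x - y) ^+ 2 / (2 * t).
  apply/le_anti; rewrite wub/=; apply: lb_le_inf.
    by exists (u x + eucl_norm (x - x) ^+ 2 / (2 * t)), x.
  by move=> _ [v _ <-]; exact: ymin.
apply/rowP => i; rewrite !mxE.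
have dwi : derivable w x (delta_mx ord0 i) by exact: diff_derivable.
apply: (@slope_eq_quadratic_majorant (fun h => w (h *: delta_mx ord0 i + x)) _ _ (2 * t)^-1).
  by rewrite scale0r add0r; exact: dwi.
move=> h; rewrite scale0r add0r wx; apply: (le_trans (wub _ y)).
have -> : eucl_norm (h *: delta_mx ord0 i + x - y) ^+ 2 =
    eucl_norm (x - y) ^+ 2 + 2 * h * (x ord0 i - y ord0 i) + h ^+ 2.
  rewrite !sqr_eucl_norm (bigD1 i)//= [in RHS](bigD1 i)//= !mxE !eqxx mulr1.
  rewrite (eq_bigr (fun j => (x - y) ord0 j ^+ 2)); first by ring.
  by move=> j ji; rewrite !mxE eqxx (negbTE ji) mulr0 add0r.
by rewrite le_eqVlt; apply/orP; left; apply/eqP; field; rewrite lt0r_neq0.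
Qed.

Lemma inf_convolution_minimizer n (u : 'rV[R]_n -> R) t M (x : 'rV[R]_n) :
  continuous u -> (forall z, `|u z| <= M) -> 0 < t -> exists y, forall z,
    u y + eucl_norm (x - y) ^+ 2 / (2 * t) <= u z + eucl_norm (x - z) ^+ 2 / (2 * t).
Proof.
move=> cu uM t0; pose F (z : 'rV[R]_n) := u z + eucl_norm (x - z) ^+ 2 / (2 * t).
have M0 : 0 <= M by apply: le_trans (uM x).
have cF : continuous F.
  have cE : continuous (fun z : 'rV[R]_n => \sum_(i < n) (x - z) ord0 i ^+ 2).
    apply: continuous_big => [|i _ z]; first exact: add_continuous.
    apply: (continuous_comp (f := fun z : 'rV[R]_n => (x - z) ord0 i) (g := fun s : R => s ^+ 2)).
      rewrite (_ : (fun z : 'rV[R]_n => _) =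
        (fun z : 'rV[R]_n => x ord0 i - z ord0 i)); last first.
        by apply/funext => z'; rewrite !mxE.
      exact: (cvgB (cvg_cst (x ord0 i)) (@coord_continuous R 1 n ord0 i z)).
    exact: exprn_continuous.
  rewrite (_ : F = fun z => u z + (\sum_(i < n) (x - z) ord0 i ^+ 2) / (2 * t)); last first.
    by apply/funext => z; rewrite /F sqr_eucl_norm.
  by move=> z; exact: (cvgD (cu z) (cvgM (cE z) (cvg_cst (2 * t)^-1))).
(* Since [rho >= 1], also [rho ^+ 2 >= 4 * M * t]. At distance at least [rho] from [x] the penalty
   is thus at least [2 * M], the largest possible gain in [u], so a minimum over the compact cube of
   half-side [b] is global. *)
pose rho := 4 * M * t + 1; pose b := `|x| + rho.
have rho1 : 1 <= rho by rewrite lerDr !mulr_ge0// ltW.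
have xb : cube n b x.
  move=> i; rewrite (le_trans (_ : _ <= `|x|))//; last by rewrite lerDl; lra.
  exact: coord_le_norm.
have [y yb yP] : exists2 c, c \in cube n b & forall z, z \in cube n b -> F c <= F z.
  apply: EVT_min_rV; [by exists x|exact: compact_cube|exact: continuous_subspaceT].
exists y => z; rewrite -/(F y) -/(F z).
have [zb|zb] := pselect (cube n b z); first by apply: yP; rewrite inE.
apply: (le_trans (yP x _)); first by rewrite inE.
have [i] : exists i, b < `|z ord0 i|.
  apply: contrapT => h; apply: zb => i; rewrite leNgt; apply/negP => bz.
  by apply: h; exists i.
move=> bz.
have rz : rho <= eucl_norm (x - z).
  apply: (le_trans _ (coord_le_eucl_norm _ _ i)); rewrite !mxE.
  have := coord_le_norm _ x i; have := lerB_dist (z ord0 i) (x ord0 i).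
  by rewrite distrC; move: bz; rewrite /b; lra.
rewrite /F subrr.
have -> : eucl_norm (0 : 'rV[R]_n) ^+ 2 = 0.
  by rewrite sqr_eucl_norm big1// => j _; rewrite mxE expr0n.
have : 2 * M <= eucl_norm (x - z) ^+ 2 / (2 * t).
  rewrite ler_pdivlMr ?mulr_gt0//.
  by apply: (@le_trans _ _ (rho ^+ 2));
    [rewrite /rho|rewrite lerXn2r// ?nnegrE ?eucl_norm_ge0]; nra.
have := uM x; have := uM z; rewrite !ler_norml => /andP[? ?] /andP[? ?]; lra.
Qed.

(** The competitor [p] strictly beats every point within [K * t] of [x], even when the penalty of
    that point is ignored. The minimizer is therefore farther away, and the gradient is its
    displacement divided by [t]. *)
Lemma gradient_inf_convolution_gt n (u : 'rV[R]_n -> R) t M (x p : 'rV[R]_n) (K : R) :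
  continuous u -> (forall z, `|u z| <= M) -> 0 < t ->
  (forall z, eucl_norm (x - z) <= K * t -> u p + eucl_norm (x - p) ^+ 2 / (2 * t) < u z) ->
  differentiable (inf_convolution u t) x ->
  K < eucl_norm (gradient (inf_convolution u t) x).
Proof.
move=> cu uM t0 pP dw.
have [y yP] := inf_convolution_minimizer _ _ _ _ x cu uM t0.
have uM' z : - M <= u z by have := uM z; rewrite ler_norml => /andP[].
rewrite (gradient_inf_convolution _ _ _ _ _ _ t0 uM' yP dw) eucl_normZ ?invr_ge0 ?ltW//.
rewrite ltr_pdivlMl// mulrC ltNge; apply/negP => /pP; apply/negP; rewrite -leNgt.
apply: le_trans (yP p); rewrite lerDl divr_ge0 ?exprn_ge0 ?eucl_norm_ge0//.
by rewrite mulr_ge0// ltW.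
Qed.

End gradient_of_inf_convolution.

(** * Spikes of small energy *)

Section hump.
Context {R : realType}.
Implicit Types s x : R.

(** Squaring the positive part removes the corners at [|s| = 1], so that the derivative [dhump] is
    continuous. *)
Definition hump s : R := Num.max 0 (1 - s ^+ 2) ^+ 2.
Definition dhump s : R := - 4 * s * Num.max 0 (1 - s ^+ 2).

(** A remainder of order [h ^+ 2] leaves an error of order [h] in the difference quotient. The
    criterion handles the squared positive part at 0 by sign cases alone. *)
Lemma is_derive_quadratic (f : R -> R) (x D C : R) :
  (forall h, `|f (h + x) - f x - h * D| <= C * h ^+ 2) -> is_derive x (1 : R) f D.
Proof.
move=> fC; have C0 : 0 <= C by have := fC 1; rewrite expr1n mulr1; apply: le_trans.
have cvgD : (fun h : R => h^-1 *: ((f \o shift x) (h *: (1 : R)) - f x)) @ 0^' --> D.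
  apply/cvgrPdist_le => e e0.
  rewrite /dnbhs; apply/nbhs_ballP; exists (e / (C + 1)) => /=.
    by rewrite divr_gt0// ltr_wpDl.
  move=> h; rewrite /ball/= sub0r normrN ltr_pdivlMr ?ltr_wpDl// => he h0.
  rewrite (_ : h *: (1 : R) = h); last exact: mulr1.
  rewrite (_ : D - _ = - (h^-1 * (f (h + x) - f x - h * D))); last first.
    by rewrite (_ : h^-1 *: _ = h^-1 * (f (h + x) - f x))//; field.
  rewrite normrN normrM normfV ler_pdivrMl ?normr_gt0//.
  apply: (le_trans (fC h)); rewrite -real_normK ?num_real//.
  have := normr_gt0 h; rewrite h0 => h1; nra.
by constructor; [apply: cvgP cvgD|exact: cvg_lim cvgD].
Qed.

Lemma is_derive_hump s : is_derive s (1 : R) hump (dhump s).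
Proof.
have D : is_derive (1 - s ^+ 2) (1 : R) (fun y : R => Num.max 0 y ^+ 2)
    (2 * Num.max 0 (1 - s ^+ 2)).
  apply: (@is_derive_quadratic _ _ _ 1) => h; rewrite mul1r.
  rewrite ler_norml; case: (leP 0 (h + _)) => h1; case: (leP 0 (1 - _)) => h2;
    apply/andP; split; nra.
have D2 : is_derive s (1 : R) (fun y : R => 1 - y ^+ 2) (- 2 * s).
  apply: (@is_derive_quadratic _ _ _ 1) => h.
  rewrite (_ : _ - _ = - (h ^+ 2)); last by ring.
  by rewrite normrN mul1r ger0_norm// sqr_ge0.
have := @is_derive1_comp R (fun y : R => Num.max 0 y ^+ 2) (fun y : R => 1 - y ^+ 2) s _ _ D D2.
congr is_derive; rewrite /dhump; ring.
Qed.

Lemma hump_ge0 s : 0 <= hump s. Proof. exact: sqr_ge0. Qed.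

Lemma hump_le1 s : hump s <= 1.
Proof. by rewrite /hump exprn_ile1// ?le_max ?lexx// ge_max ler01 lerBlDr lerDl sqr_ge0. Qed.

Lemma hump0 : hump 0 = 1.
Proof. by rewrite /hump expr0n subr0 max_r// expr1n. Qed.

Lemma max_hump_eq0 s : 1 <= `|s| -> Num.max 0 (1 - s ^+ 2) = 0 :> R.
Proof.
by move=> s1; rewrite max_l// subr_le0 -real_normK ?num_real// exprn_ege1.
Qed.

Lemma hump_eq0 s : 1 <= `|s| -> hump s = 0.
Proof. by move=> s1; rewrite /hump max_hump_eq0// expr0n. Qed.

Lemma dhump_eq0 s : 1 <= `|s| -> dhump s = 0.
Proof. by move=> s1; rewrite /dhump max_hump_eq0// mulr0. Qed.

Lemma dhump_le s : `|dhump s| <= 4.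
Proof.
have [s1|s1] := leP 1 `|s|; first by rewrite dhump_eq0// normr0.
rewrite /dhump !normrM normrN (ger0_norm (ler0n R 4)).
have : `|Num.max 0 (1 - s ^+ 2)| <= 1.
  by rewrite ger0_norm ?le_max ?lexx// ge_max ler01 lerBlDr lerDl sqr_ge0.
have := normr_ge0 s; have := normr_ge0 (Num.max 0 (1 - s ^+ 2)); nra.
Qed.

Lemma continuous_dhump : continuous dhump.
Proof.
have c1 : continuous (fun s : R => 1 - s ^+ 2).
  by move=> s; exact: (cvgB (@cst_continuous _ _ (1 : R) s) (@exprn_continuous R 2 s)).
have c2 : continuous (fun s : R => Num.max 0 (1 - s ^+ 2)).
  by move=> s; exact: (continuous_max (@cst_continuous _ _ 0 s) (c1 s)).
have c3 : continuous (fun s : R => - 4 * s).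
  by move=> s; exact: mulrl_continuous.
by move=> s; exact: (cvgM (c3 s) (c2 s)).
Qed.

End hump.

(** * Rows of bumps along one coordinate *)

Section comb.
Context {R : realType}.
Implicit Types (s x sigma : R) (M : nat).

Definition comb M sigma x : R := \sum_(a < M.+1) hump ((x - a%:R / M%:R) / sigma).
Definition dcomb M sigma x : R :=
  \sum_(a < M.+1) (dhump ((x - a%:R / M%:R) / sigma) / sigma).
Definition teeth M sigma : set R := [set s | exists a : 'I_M.+1, `|s - a%:R / M%:R| <= sigma].

Lemma is_derive_affine (c b x : R) : is_derive x (1 : R) (fun y => (y - c) * b) b.
Proof.
apply: (@is_derive_quadratic _ _ _ _ 0) => h.
by rewrite mul0r (_ : _ - h * b = 0) ?normr0//; ring.
Qed.

Lemma is_derive_comb M sigma x : is_derive x (1 : R) (comb M sigma) (dcomb M sigma x).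
Proof.
rewrite (_ : comb M sigma = \sum_(a < M.+1) (fun y => hump ((y - a%:R / M%:R) / sigma))).
  apply: is_derive_sum => a.
  exact: (is_derive1_comp (is_derive_hump _) (is_derive_affine _ _ _)).
by apply/funext => y; rewrite fct_sumE.
Qed.

Lemma continuous_comb M sigma : continuous (comb M sigma).
Proof.
move=> s; apply: differentiable_continuous; apply/derivable1_diffP.
by have [] := is_derive_comb M sigma s.
Qed.

Lemma continuous_dcomb M sigma : continuous (dcomb M sigma).
Proof.
apply: continuous_big => [|a _ s]; first exact: add_continuous.
apply: cvgM; last exact: cvg_cst.
apply: (continuous_comp (f := fun s => (s - a%:R / M%:R) / sigma)); last exact: continuous_dhump.
exact: (cvgM (cvgB (@cvg_id _ (nbhs s)) (@cvg_cst _ _ _ _ _)) (@cvg_cst _ _ _ _ _)).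
Qed.

Lemma comb_ge0 M sigma x : 0 <= comb M sigma x.
Proof. by apply: sumr_ge0 => a _; exact: hump_ge0. Qed.

Lemma ge1_dist_div s sigma : 0 < sigma -> (1 <= `|s / sigma|) = (sigma <= `|s|).
Proof.
by move=> s0; rewrite normrM normfV (gtr0_norm s0) ler_pdivlMr// mul1r.
Qed.

Lemma comb_neq0 M sigma x : 0 < sigma -> comb M sigma x != 0 ->
  exists a : 'I_M.+1, `|x - a%:R / M%:R| < sigma.
Proof.
move=> s0; apply: contra_neqP => xs; apply: big1 => a _; apply: hump_eq0.
by rewrite ge1_dist_div// leNgt; apply/negP => ax; apply: xs; exists a.
Qed.

Lemma dcomb_neq0 M sigma x : 0 < sigma -> dcomb M sigma x != 0 ->
  exists a : 'I_M.+1, `|x - a%:R / M%:R| < sigma.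
Proof.
move=> s0; apply: contra_neqP => xs; apply: big1 => a _; rewrite dhump_eq0 ?mul0r//.
by rewrite ge1_dist_div// leNgt; apply/negP => ax; apply: xs; exists a.
Qed.

(* The teeth have disjoint interiors: distinct grid points are 1/M >= 2 sigma apart. *)
Lemma comb_le1 M sigma x : 0 < sigma -> 2 * sigma * M%:R <= 1 -> comb M sigma x <= 1.
Proof.
move=> s0 sM; have [->//|/comb_neq0 -/(_ s0) [a xa]] := eqVneq (comb M sigma x) 0.
rewrite /comb (bigD1 a)//= big1 ?addr0 ?hump_le1// => b ba.
apply: hump_eq0; rewrite ge1_dist_div// leNgt; apply/negP => xb.
have M0 : 0 < M%:R :> R.
  rewrite ltr0n lt0n; apply: contra_neq ba => M0; apply/val_inj => /=.
  have le0 (c : 'I_M.+1) : nat_of_ord c = 0%N.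
    by apply/eqP; rewrite -leqn0 (leq_trans (leq_ord c))// M0.
  by rewrite !le0.
have /negP := ba; apply; apply/eqP/val_inj => /=.
have ab : `|b%:R - a%:R| < 1 :> R.
  rewrite -(@ltr_pM2r _ M%:R^-1) ?invr_gt0// -{1}[M%:R^-1]gtr0_norm ?invr_gt0// -normrM mul1r.
  have sM' : 2 * sigma <= M%:R^-1 by rewrite -[leRHS]mul1r ler_pdivlMr.
  apply: lt_le_trans sM'.
  rewrite (_ : (b%:R - a%:R) / _ = (x - a%:R / M%:R) - (x - b%:R / M%:R)); last by ring.
  by apply: (le_lt_trans (ler_normB _ _)); lra.
have := ab; have [lab|lba] := leqP a b.
  rewrite -natrB// ger0_norm// (ltr_nat R _ 1) ltnS leqn0 subn_eq0 => lba.
  by apply/eqP; rewrite eqn_leq lba lab.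
rewrite distrC -natrB ?(ltnW lba)// ger0_norm// (ltr_nat R _ 1) ltnS leqn0 subn_eq0 => lab.
by apply/eqP; rewrite eqn_leq lab ltnW.
Qed.

Lemma comb_grid M sigma (a : 'I_M.+1) : 0 < sigma -> 2 * sigma * M%:R <= 1 ->
  comb M sigma (a%:R / M%:R) = 1.
Proof.
move=> s0 sM; apply/le_anti; rewrite comb_le1//= /comb (bigD1 a)//=.
by rewrite subrr mul0r hump0 lerDl sumr_ge0// => b _; exact: hump_ge0.
Qed.

(** All [M.+1] summands are bounded at once, although the teeth hardly overlap. The lost factor is
    harmless, since the number of averaged scales is chosen after [M]. *)
Lemma dcomb_le M sigma x : 0 < sigma -> `|dcomb M sigma x| <= 4 * M.+1%:R / sigma.
Proof.
move=> s0; apply: (le_trans (ler_norm_sum _ _ _)).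
apply: (@le_trans _ _ (\sum_(a < M.+1) 4 / sigma)).
  apply: ler_sum => a _; rewrite normrM normfV (gtr0_norm s0).
  by rewrite ler_pM2r ?invr_gt0// dhump_le.
by rewrite sumr_const card_ord -mulr_natr; lra.
Qed.

Lemma measurable_teeth M sigma : measurable (teeth M sigma).
Proof.
rewrite (_ : teeth M sigma =
    \bigcup_(a in [set: 'I_M.+1]) `[a%:R / M%:R - sigma, a%:R / M%:R + sigma]%classic).
  by apply: fin_bigcup_measurable.
apply/seteqP; split => [s [a sa]|s [a _ sa]]; exists a => //=; move: sa;
  by rewrite /= in_itv/= ler_distl.
Qed.

Lemma lebesgue_teeth M sigma : 0 <= sigma ->
  (lebesgue_measure (teeth M sigma) <= (2 * M.+1%:R * sigma)%:E)%E.
Proof.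
move=> s0.
pose I (a : nat) := `[a%:R / M%:R - sigma, a%:R / M%:R + sigma]%classic : set R.
apply: (@le_trans _ _ (\sum_(a < M.+1) lebesgue_measure (I a))%E).
  apply: content_subadditive; [by move=> k _; exact: measurable_itv|exact: measurable_teeth|].
  rewrite -bigcup_mkord => s [a sa].
  by exists a => //=; rewrite /I/= in_itv/= -ler_distl.
rewrite (eq_bigr (fun=> (2 * sigma)%:E)); last first.
  move=> a _; rewrite /I lebesgue_measure_itv/= lte_fin; case: ifPn => h.
    by rewrite -EFinD; congr EFin; lra.
  by congr EFin; lra.
by rewrite sumEFin lee_fin sumr_const card_ord -mulr_natr; lra.
Qed.

End comb.

(** * Products of combs, their dyadic averages and their energy *)

Section spikes.
Context {R : realType}.
Implicit Types (sigma rho : R) (M N : nat).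

Lemma is_derive_prod_coord n (f : R -> R) (d : R) (i : 'I_n) (x : 'rV[R]_n) :
  is_derive (x ord0 i) (1 : R) f d ->
  is_derive x (delta_mx ord0 i) (fun y : 'rV[R]_n => \prod_(l < n) f (y ord0 l))
    (d * \prod_(l < n | l != i) f (x ord0 l)).
Proof.
move=> fd; set c := \prod_(l < n | _) _.
have := (is_derive_line _ (fun y : 'rV[R]_n => \prod_(l < n) f (y ord0 l)) x
  (delta_mx ord0 i) 0 (d * c)).1.
rewrite scale0r add0r; apply.
(* Along direction [i] only factor [i] varies, so the restriction is a translate of [f] times the
   constant [c]; writing it with affine maps leaves only the chain rule. *)
rewrite (_ : (fun h => _) = (fun s => (s - 0) * c) \o f \o (fun h => (h - (- x ord0 i)) * 1)).
  rewrite [d * c]mulrC -[c * d]mulr1.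
  apply: is_derive1_comp; last exact: is_derive_affine.
  apply: is_derive1_comp; first exact: is_derive_affine.
  by rewrite opprK add0r mulr1.
apply/funext => h /=; rewrite subr0 mulr1 opprK (bigD1 i)//= !mxE !eqxx mulr1.
congr (_ * _); apply: eq_bigr => l li.
by rewrite !mxE eqxx (negbTE li) mulr0 add0r.
Qed.

Definition grid_nbhd n M rho : set 'rV[R]_n :=
  [set x | forall i, exists a : 'I_M.+1, `|x ord0 i - a%:R / M%:R| < rho].
Arguments grid_nbhd : clear implicits.

Definition grid_comb n M sigma (x : 'rV[R]_n) : R := \prod_(l < n) comb M sigma (x ord0 l).
Definition dgrid_comb n M sigma (i : 'I_n) (x : 'rV[R]_n) : R :=
  dcomb M sigma (x ord0 i) * \prod_(l < n | l != i) comb M sigma (x ord0 l).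
Definition grid_teeth n M sigma : set 'rV[R]_n := [set x | forall i, teeth M sigma (x ord0 i)].
Arguments grid_teeth : clear implicits.

Lemma is_derive_grid_comb n M sigma i (x : 'rV[R]_n) :
  is_derive x (delta_mx ord0 i) (grid_comb n M sigma) (dgrid_comb n M sigma i x).
Proof. exact/is_derive_prod_coord/is_derive_comb. Qed.

Lemma continuous_comb_coord n M sigma (i : 'I_n) :
  continuous (fun x : 'rV[R]_n => comb M sigma (x ord0 i)).
Proof.
move=> x; apply: (continuous_comp (f := fun x : 'rV[R]_n => x ord0 i)).
  exact: coord_continuous.
exact: continuous_comb.
Qed.

Lemma continuous_grid_comb n M sigma : continuous (grid_comb n M sigma).
Proof.
apply: continuous_big => [|l _]; first exact: mul_continuous.
exact: continuous_comb_coord.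
Qed.

Lemma continuous_dgrid_comb n M sigma i : continuous (dgrid_comb n M sigma i).
Proof.
have c1 : continuous (fun x : 'rV[R]_n => dcomb M sigma (x ord0 i)).
  move=> x; apply: (continuous_comp (f := fun x : 'rV[R]_n => x ord0 i)).
    exact: coord_continuous.
  exact: continuous_dcomb.
have c2 : continuous (fun x : 'rV[R]_n => \prod_(l < n | l != i) comb M sigma (x ord0 l)).
  apply: continuous_big => [|l _]; first exact: mul_continuous.
  exact: continuous_comb_coord.
by move=> x; exact: (cvgM (c1 x) (c2 x)).
Qed.

Lemma grid_comb_ge0 n M sigma (x : 'rV[R]_n) : 0 <= grid_comb n M sigma x.
Proof. by apply: prodr_ge0 => l _; exact: comb_ge0. Qed.

Lemma grid_comb_le1 n M sigma (x : 'rV[R]_n) : 0 < sigma -> 2 * sigma * M%:R <= 1 ->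
  grid_comb n M sigma x <= 1.
Proof. by move=> s0 sM; apply: prodr_ile1 => l _; rewrite comb_ge0 comb_le1. Qed.

Lemma grid_comb_neq0 n M sigma (x : 'rV[R]_n) : 0 < sigma -> grid_comb n M sigma x != 0 ->
  grid_nbhd n M sigma x.
Proof. by move=> s0 /prodf_neq0 xs i; apply: comb_neq0 => //; exact: xs. Qed.

Lemma dgrid_comb_neq0 n M sigma i (x : 'rV[R]_n) : 0 < sigma -> dgrid_comb n M sigma i x != 0 ->
  grid_nbhd n M sigma x.
Proof.
move=> s0; rewrite mulf_eq0 negb_or => /andP[xi /prodf_neq0 xs] l.
have [->|li] := eqVneq l i; first exact: dcomb_neq0.
by apply: comb_neq0 => //; exact: xs.
Qed.

Lemma dgrid_comb_le n M sigma i (x : 'rV[R]_n) : 0 < sigma -> 2 * sigma * M%:R <= 1 ->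
  `|dgrid_comb n M sigma i x| <= 4 * M.+1%:R / sigma * \1_(grid_teeth n M sigma) x.
Proof.
move=> s0 sM; have [->|/dgrid_comb_neq0 xs] := eqVneq (dgrid_comb n M sigma i x) 0.
  by rewrite normr0 mulr_ge0// divr_ge0// ?mulr_ge0// ltW.
rewrite indicE mem_set ?mulr1; last first.
  by move=> l; have [a xa] := xs s0 l; exists a; exact: ltW.
rewrite normrM -[leRHS]mulr1; apply: ler_pM => //; first exact: dcomb_le.
rewrite ger0_norm; first by apply: prodr_ile1 => l _; rewrite comb_ge0 comb_le1.
by apply: prodr_ge0 => l _; exact: comb_ge0.
Qed.

Lemma measurable_grid_teeth n M sigma : measurable (grid_teeth n M sigma).
Proof.
by apply: (@measurable_rV_box R n (fun=> teeth M sigma)) => _; exact: measurable_teeth.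
Qed.

Lemma lebesgue_grid_teeth n M sigma : 0 <= sigma ->
  (lebesgue_rV n (grid_teeth n M sigma) <= ((2 * M.+1%:R * sigma) ^+ n)%:E)%E.
Proof.
move=> s0; rewrite [leLHS](@lebesgue_rV_box R n (fun=> teeth M sigma)); last first.
  by move=> _; exact: measurable_teeth.
have c0 : 0 <= 2 * M.+1%:R * sigma by rewrite !mulr_ge0.
elim: n => [|n IH]; first by rewrite big_ord0 expr0.
rewrite big_ord_recl exprS EFinM lee_pmul//.
  by apply: prode_ge0.
exact: lebesgue_teeth.
Qed.

(* The last present term of a geometric sum dominates the sum up to a factor 2. *)
Lemma dyadic_sum_le n N (b : nat -> bool) : (0 < n)%N ->
  (\sum_(j < N) 2 ^+ j * (b j)%:R) ^+ n <=
  2 ^+ n * \sum_(j < N) 2 ^+ j ^+ n * (b j)%:R :> R.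
Proof.
case: n => [//|n _]; elim: N => [|N IH]; first by rewrite !big_ord0 mulr0 expr0n.
rewrite [in leLHS]big_ord_recr [in leRHS]big_ord_recr/=.
case: (b N); last by rewrite !mulr0 !addr0.
rewrite !mulr1.
have h0 j : 0 <= 2 ^+ j * (b j)%:R :> R by rewrite mulr_ge0// exprn_ge0.
have h : \sum_(j < N) 2 ^+ j * (b j)%:R + 2 ^+ N <= 2 * 2 ^+ N :> R.
  suff : \sum_(j < N) 2 ^+ j * (b j)%:R <= 2 ^+ N :> R by lra.
  elim: N {IH} => [|N IH]; first by rewrite big_ord0 expr0.
  rewrite big_ord_recr/= exprS.
  have : 2 ^+ N * (b N)%:R <= 2 ^+ N :> R.
    by rewrite ler_piMr ?exprn_ge0//; case: (b N).
  lra.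
apply: (@le_trans _ _ ((2 * 2 ^+ N) ^+ n.+1)).
  by rewrite lerXn2r// ?nnegrE ?mulr_ge0 ?addr_ge0 ?exprn_ge0// sumr_ge0.
by rewrite exprMn mulrDr lerDr mulr_ge0 ?exprn_ge0// sumr_ge0.
Qed.

Lemma dyadic_scale_le rho j : 0 <= rho -> rho * 2^-1 ^+ j <= rho.
Proof.
move=> r0; apply: ler_piMr => //; apply: exprn_ile1; first by rewrite invr_ge0.
by rewrite invf_le1 ?ler1n.
Qed.

(** The [n]-energy is scale invariant: at scale [j] the derivative has size of order [2 ^+ j] on a
    set of measure of order [2 ^- j] to the power [n], so every scale contributes the same amount.
    By [dyadic_sum_le] the cross terms cost only a factor [2 ^+ n], and the total is linear in
    [N]. *)
Lemma integral_dyadic_grid_le n N M rho (i : 'I_n) : (0 < n)%N -> 0 < rho ->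
  2 * rho * M%:R <= 1 ->
  (\int[lebesgue_rV n]_x
    (`|\sum_(j < N) dgrid_comb n M (rho * 2^-1 ^+ j) i x| ^+ n)%:E <=
    ((16 * M.+1%:R ^+ 2) ^+ n * N%:R)%:E)%E.
Proof.
move=> n0 r0 rM; pose s (j : nat) : R := rho * 2^-1 ^+ j.
have s0 j : 0 < s j by rewrite mulr_gt0// exprn_gt0// invr_gt0.
have sM j : 2 * s j * M%:R <= 1.
  by apply: le_trans rM; rewrite ler_wpM2r// ler_pM2l// dyadic_scale_le// ltW.
pose c : R := 4 * M.+1%:R / rho.
have c0 : 0 <= c by rewrite divr_ge0 ?mulr_ge0// ltW.
pose T j := grid_teeth n M (s j).
have mT j : measurable (T j) by exact: measurable_grid_teeth.
pose g x : R := \sum_(j < N) (c ^+ n * 2 ^+ n * 2 ^+ j ^+ n) * \1_(T j) x.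
apply: (@le_trans _ _ (\int[lebesgue_rV n]_x (g x)%:E)%E).
  apply: ge0_le_integral => //.
  - apply/measurable_EFinP; apply: measurable_funX; apply: measurableT_comp => //.
    apply: measurable_sum => j; apply: continuous_measurable_rV.
    exact: continuous_dgrid_comb.
  - apply/measurable_EFinP; apply: measurable_sum => j.
    by apply: measurable_funM => //; exact: measurable_indic.
  - move=> x _; rewrite lee_fin.
    apply: (@le_trans _ _ ((c * \sum_(j < N) 2 ^+ j * (x \in T j)%:R) ^+ n)).
      have S0 : 0 <= \sum_(j < N) 2 ^+ j * (x \in T j)%:R :> R.
        by apply: sumr_ge0 => j _; rewrite mulr_ge0// exprn_ge0.
      apply: lerXn2r; rewrite ?nnegrE//; first exact: mulr_ge0.
      rewrite (le_trans (ler_norm_sum _ _ _))// mulr_sumr; apply: ler_sum => j _.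
      apply: (le_trans (dgrid_comb_le _ _ _ i x (s0 j) (sM j))).
      rewrite indicE mulrA ler_wpM2r//= /c /s invfM exprVn invrK.
      by rewrite mulrA.
    rewrite exprMn /g [leRHS](_ : _ =
      c ^+ n * (2 ^+ n * \sum_(j < N) 2 ^+ j ^+ n * (x \in T j)%:R)).
      by rewrite ler_wpM2l ?exprn_ge0//; exact: (dyadic_sum_le n N (fun j => x \in T j)).
    by rewrite !mulr_sumr; apply: eq_bigr => j _; rewrite indicE !mulrA.
rewrite /g; under eq_integral do rewrite -sumEFin.
rewrite ge0_integral_sum//; last 2 first.
- move=> j; apply/measurable_EFinP.
  by apply: measurable_funM => //; exact: measurable_indic.
- by move=> j x _; rewrite lee_fin mulr_ge0// !mulr_ge0 ?exprn_ge0.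
apply: (@le_trans _ _ (\sum_(j < N) ((16 * M.+1%:R ^+ 2) ^+ n)%:E)%E); last first.
  by rewrite sumEFin lee_fin sumr_const card_ord mulr_natr.
apply: lee_sum => j _.
under eq_integral do rewrite EFinM.
rewrite ge0_integralZl_EFin//; last 2 first.
- by apply/measurable_EFinP; exact: measurable_indic.
- by rewrite !mulr_ge0 ?exprn_ge0.
rewrite integral_indic// setIT.
apply: (le_trans (lee_wpmul2l _ (lebesgue_grid_teeth n M _ (ltW (s0 j))))).
  by rewrite lee_fin !mulr_ge0 ?exprn_ge0.
rewrite -EFinM lee_fin -!exprMn.
(* The height [c * 2 * 2 ^+ j] times the width [2 * M.+1%:R * s j]: the factors [rho] and [2 ^+ j]
   cancel. *)
rewrite (_ : _ * _ = 16 * M.+1%:R ^+ 2)//.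
rewrite /c /s exprVn; field.
by rewrite expf_neq0// lt0r_neq0.
Qed.

(** All that the later argument uses about one level: [M] is the inverse mesh, [rho] the radius, [h]
    the depth, and [e] bounds the energy of each partial derivative [d i]. *)
Record spikes n M rho (h e : R) (v : 'rV[R]_n -> R) (d : 'I_n -> 'rV[R]_n -> R) : Prop := {
  spikes_continuous : continuous v;
  spikes_partial_continuous : forall i, continuous (d i);
  spikes_partial : forall i (x : 'rV[R]_n), is_derive x (delta_mx ord0 i) v (d i x);
  spikes_range : forall x, - h <= v x <= 0;
  spikes_grid : forall x : 'rV[R]_n,
    (forall i, exists a : 'I_M.+1, x ord0 i = a%:R / M%:R) -> v x = - h;
  spikes_support : forall x, v x != 0 -> grid_nbhd n M rho x;
  spikes_partial_support : forall i x, d i x != 0 -> grid_nbhd n M rho x;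
  spikes_energy : forall i, (\int[lebesgue_rV n]_x (`|d i x| ^+ n)%:E <= e%:E)%E }.

(** The combs of the radii [rho * 2^-1 ^+ j] all equal 1 on the grid, so averaging [N] of them keeps
    the depth [h], while the energy is at most of order [N] to the power [1 - n]. *)
Lemma spikes_exist n M rho (h e : R) : (2 <= n)%N -> 0 < rho -> 2 * rho * M%:R <= 1 ->
  0 <= h <= 1 -> 0 < e -> exists v d, spikes n M rho h e v d.
Proof.
move=> n2 r0 rM /andP[h0 h1] e0.
have n0 : (0 < n)%N by exact: ltn_trans n2.
pose A : R := (16 * M.+1%:R ^+ 2) ^+ n.
have A0 : 0 <= A by rewrite exprn_ge0// mulr_ge0// exprn_ge0.
(* The final energy bound is [A / N], hence [N] is taken at least [A / e]. *)
pose N := (Num.truncn (A / e)).+1.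
have AN : A / e <= N%:R by rewrite ltW// truncnS_gt.
have N0 : 0 < N%:R :> R by rewrite ltr0n.
pose s (j : nat) : R := rho * 2^-1 ^+ j.
have s0 j : 0 < s j by rewrite mulr_gt0// exprn_gt0// invr_gt0.
have sr j : s j <= rho by rewrite dyadic_scale_le// ltW.
have sM j : 2 * s j * M%:R <= 1.
  by apply: le_trans rM; rewrite ler_wpM2r// ler_pM2l.
pose c : R := h / N%:R.
have c0 : 0 <= c by rewrite divr_ge0.
pose v (x : 'rV[R]_n) := - c * \sum_(j < N) grid_comb n M (s j) x.
pose d i (x : 'rV[R]_n) := - c * \sum_(j < N) dgrid_comb n M (s j) i x.
exists v, d; split.
- have cS : continuous (fun x : 'rV[R]_n => \sum_(j < N) grid_comb n M (s j) x).
    apply: continuous_big => [|j _]; [exact: add_continuous|exact: continuous_grid_comb].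
  by move=> x; exact: (cvgM (cvg_cst (- c)) (cS x)).
- move=> i.
  have cS : continuous (fun x : 'rV[R]_n => \sum_(j < N) dgrid_comb n M (s j) i x).
    apply: continuous_big => [|j _]; [exact: add_continuous|exact: continuous_dgrid_comb].
  by move=> x; exact: (cvgM (cvg_cst (- c)) (cS x)).
- move=> i x.
  have D := @is_derive_sum R _ _ N (fun j => grid_comb n M (s j)) x (delta_mx ord0 i)
    (fun j => dgrid_comb n M (s j) i x) (fun j => is_derive_grid_comb _ _ _ _ _).
  have := is_deriveZ (- c) D; congr is_derive.
  by apply/funext => y; rewrite /v /= fct_sumE.
- move=> x; rewrite /v mulNr lerN2 oppr_le0; apply/andP; split; last first.
    by rewrite mulr_ge0// sumr_ge0// => j _; exact: grid_comb_ge0.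
  rewrite /c -mulrA ler_piMr// ler_pdivrMl// mulr1.
  apply: (@le_trans _ _ (\sum_(j < N) 1)); last by rewrite sumr_const card_ord.
  by apply: ler_sum => j _; exact: grid_comb_le1.
- move=> x xg; rewrite /v (eq_bigr (fun=> 1)).
    by rewrite sumr_const card_ord /c mulNr mulfVK// lt0r_neq0.
  move=> j _; rewrite /grid_comb big1// => i _.
  by have [a ->] := xg i; exact: comb_grid.
- move=> x vx i; apply: contrapT => xi; move/eqP: vx; apply.
  rewrite /v big1 ?mulr0// => j _; apply/eqP; apply: contrapT => /negP.
  move=> /(grid_comb_neq0 _ _ _ _ (s0 j))/(_ i)[a xa]; apply: xi.
  by exists a; exact: lt_le_trans xa (sr j).
- move=> i x dx l; apply: contrapT => xl; move/eqP: dx; apply.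
  rewrite /d big1 ?mulr0// => j _; apply/eqP; apply: contrapT => /negP.
  move=> /(dgrid_comb_neq0 _ _ _ _ _ (s0 j))/(_ l)[a xa]; apply: xl.
  by exists a; exact: lt_le_trans xa (sr j).
- move=> i; under eq_integral do rewrite /d normrM normrN (ger0_norm c0) exprMn EFinM.
  rewrite ge0_integralZl_EFin ?exprn_ge0//; last first.
    apply/measurable_EFinP; apply: measurable_funX; apply: measurableT_comp => //.
    apply: measurable_sum => j; apply: continuous_measurable_rV.
    exact: continuous_dgrid_comb.
  apply: (le_trans (lee_wpmul2l _ (integral_dyadic_grid_le n N M rho i n0 r0 rM))).
    by rewrite lee_fin exprn_ge0.
  rewrite -EFinM lee_fin -/A.
  (* Here [n >= 2] enters: [c <= 1 / N] gives [c ^+ n] at most [1 / N ^+ 2], which outweighs the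
     factor [N] from the sum over the scales. *)
  have cN : c ^+ n <= N%:R^-1 ^+ 2.
    apply: (@le_trans _ _ (N%:R^-1 ^+ n)).
      by rewrite lerXn2r ?nnegrE// ler_piMl.
    by rewrite ler_wiXn2l// invf_le1 ?ler1n.
  apply: (@le_trans _ _ (N%:R^-1 ^+ 2 * (A * N%:R))).
    by rewrite ler_wpM2r// mulr_ge0.
  rewrite mulrCA expr2 mulfVK ?lt0r_neq0//.
  by rewrite ler_pdivrMr// mulrC -ler_pdivrMr.
Qed.

End spikes.

Arguments spikes_continuous {R n M rho h e v d}.
Arguments spikes_partial_continuous {R n M rho h e v d}.
Arguments spikes_partial {R n M rho h e v d}.
Arguments spikes_range {R n M rho h e v d}.
Arguments spikes_grid {R n M rho h e v d}.
Arguments spikes_support {R n M rho h e v d}.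
Arguments spikes_partial_support {R n M rho h e v d}.
Arguments spikes_energy {R n M rho h e v d}.

(** * The exceptional set and the theorem *)

Section scales.
Context {R : realType}.
Implicit Types (x : R) (k : nat).

(* At level k the grid has mesh 32^-k, the spikes have depth 8^-k and radius
   rad k = 2^-5 64^-k.  The radius is summably small against the mesh, so that
   the doubled spikes miss a set of positive measure; and mesh^2 / depth is much
   smaller than rad k.+1, so that consecutive ranges of t overlap. *)
Definition rad k : R := 2^-1 ^+ 5 * (2^-1 ^+ k) ^+ 6.

Lemma half_pow_gt0 k : 0 < 2^-1 ^+ k :> R.
Proof. by rewrite exprn_gt0// invr_gt0. Qed.

Lemma half_pow_le1 k : 2^-1 ^+ k <= 1 :> R.
Proof. by rewrite exprn_ile1 ?invr_ge0// invf_le1 ?ler1n. Qed.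

Lemma rad_gt0 k : 0 < rad k.
Proof. by rewrite mulr_gt0 ?exprn_gt0 ?half_pow_gt0 ?invr_gt0. Qed.

Lemma rad_le j k : (j <= k)%N -> rad k <= rad j.
Proof.
move=> jk; rewrite ler_pM2l ?half_pow_gt0//.
apply: lerXn2r; [exact/ltW/half_pow_gt0|exact/ltW/half_pow_gt0|].
by apply: ler_wiXn2l; rewrite ?invr_ge0// invf_le1 ?ler1n.
Qed.

Lemma mesh_pow k : (32 ^ k)%:R * (2^-1 ^+ k) ^+ 5 = 1 :> R.
Proof.
rewrite natrX exprAC -exprMn (_ : 32 * 2^-1 ^+ 5 = 1) ?expr1n//.
by rewrite [2^-1 ^+ 5]exprVn; lra.
Qed.

Lemma rad_mesh k : rad k * (32 ^ k)%:R = 2^-1 ^+ 5 * 2^-1 ^+ k.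
Proof.
rewrite /rad (exprS (2^-1 ^+ k) 5) -mulrA -[X in _ * X]mulrA.
by rewrite [(2^-1 ^+ k) ^+ 5 * _]mulrC mesh_pow mulr1.
Qed.

Lemma rad_mesh_le1 k : 2 * rad k * (32 ^ k)%:R <= 1.
Proof.
rewrite -mulrA rad_mesh; have := half_pow_le1 k.
by rewrite [2^-1 ^+ 5]exprVn; lra.
Qed.

Definition good : set R := `[0, 1]%classic `\` \bigcup_k teeth (32 ^ k) (2 * rad k).

Lemma measurable_good : measurable good.
Proof.
apply: measurableD => //; apply: bigcup_measurable => k _; exact: measurable_teeth.
Qed.

(** The doubled teeth of level [k] have measure at most [8 * 32 ^ k * rad k], which is
    [2^-1 ^+ k / 4]; over all levels they remove at most half of the unit interval. *)
Lemma lebesgue_good : (0 < lebesgue_measure good)%E.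
Proof.
pose T := \bigcup_k teeth (32 ^ k) (2 * rad k).
have mT : measurable T by apply: bigcup_measurable => k _; exact: measurable_teeth.
have T2 : (lebesgue_measure T <= (2^-1)%:E)%E.
  apply: (@le_trans _ _ (\sum_(k <oo) lebesgue_measure (teeth (32 ^ k) (2 * rad k)))%E).
    by apply: measure_sigma_subadditive => // k; exact: measurable_teeth.
  apply: lime_le; first by apply: is_cvg_nneseries => k _ _; exact: measure_ge0.
  near=> N.
  apply: (@le_trans _ _ (\sum_(0 <= k < N) (4^-1 * 2^-1 ^+ k)%:E)%E).
    apply: lee_sum => k _; apply: (le_trans (lebesgue_teeth _ _ _)).
      by rewrite mulr_ge0// ltW// rad_gt0.
    rewrite lee_fin.
    have M1 : (32 ^ k).+1%:R <= 2 * (32 ^ k)%:R :> R.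
      by rewrite -natr1 mulrDl mul1r lerD2l ler1n expn_gt0.
    have := rad_mesh k; have := rad_gt0 k; have := half_pow_gt0 k; rewrite [2^-1 ^+ 5]exprVn; nra.
  rewrite sumEFin lee_fin.
  have := @series_geometric_le R (fun k => 4^-1 * 2^-1 ^+ k) 4^-1 _ N.
  rewrite seriesEnat/= => /(_ _)/le_trans h.
  apply: (le_trans (ler_norm _)); apply: h; last by lra.
  by move=> k; rewrite ger0_norm// mulr_ge0// ?invr_ge0// ltW// half_pow_gt0.
have : (lebesgue_measure (`[0%R, 1%R]%classic : set R) <=
    lebesgue_measure good + lebesgue_measure T)%E.
  apply: (le_trans _ (measureU2 lebesgue_measure measurable_good mT)).
  apply: le_measure; rewrite ?inE//; first by apply: measurableU => //; exact: measurable_good.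
  by move=> s s01; have [Ts|Ts] := pselect (T s); [right|left].
rewrite lebesgue_measure_itv/= lte_fin ltr01 -EFinD subr0 => h.
rewrite lt_neqAle measure_ge0 andbT; apply/eqP => g0.
by move: h; rewrite -g0 add0e => /le_trans/(_ T2); rewrite lee_fin; lra.
Unshelve. all: by end_near. Qed.

(** One good coordinate already keeps a point away from all spikes. Imposing the condition on every
    coordinate turns the set into a product, whose measure is computed factor by factor. *)
Definition good_rV n : set 'rV[R]_n := [set x | forall i, good (x ord0 i)].

Lemma measurable_good_rV n : measurable (good_rV n).
Proof. by apply: (@measurable_rV_box R n (fun=> good)) => _; exact: measurable_good. Qed.

Lemma lebesgue_good_rV n : (0 < lebesgue_rV n (good_rV n))%E.
Proof.
rewrite [ltRHS](@lebesgue_rV_box R n (fun=> good)); last by move=> _; exact: measurable_good.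
by elim/big_ind : _ => // [x y|_ _]; [exact: mule_gt0|exact: lebesgue_good].
Qed.

Lemma grid_approx M x : (0 < M)%N -> 0 <= x <= 1 ->
  exists a : 'I_M.+1, `|x - a%:R / M%:R| <= M%:R^-1.
Proof.
move=> M0 /andP[x0 x1].
have M0' : 0 < M%:R :> R by rewrite ltr0n.
have xM : 0 <= x * M%:R by rewrite mulr_ge0.
have /andP[ax xa] := truncn_itv xM.
have aM : (Num.truncn (x * M%:R) < M.+1)%N.
  rewrite ltnS -(ler_nat R) (le_trans ax)// ler_piMl// ltW.
exists (Ordinal aM) => /=.
have -> : x - (Num.truncn (x * M%:R))%:R / M%:R = (x * M%:R - (Num.truncn (x * M%:R))%:R) / M%:R.
  by rewrite mulrBl mulfK// lt0r_neq0.
rewrite normrM normfV (gtr0_norm M0') ler_piMl ?invr_ge0 ?ltW//.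
by rewrite ger0_norm ?subr_ge0// ltrBlDl natr1.
Qed.

(** The radii decrease to 0, so the least [m] with [rad m <= K * t] exists. It exceeds [k0] because
    [K * t < rad k0], and [k] is its predecessor. *)
Lemma scale_exists k0 (K t : R) : 0 < K -> 0 < t -> t < rad k0 / K ->
  exists k, [/\ (k0 <= k)%N, K * t < rad k & rad k.+1 <= K * t].
Proof.
move=> K0 t0 tk0.
have Kt0 : 0 < K * t by rewrite mulr_gt0.
have ex : exists m, rad m <= K * t.
  have : (geometric (1 : R) 2^-1) @ \oo --> (0 : R).
    by apply: cvg_geometric; rewrite ger0_norm ?invr_ge0// invf_lt1 ?ltr1n.
  move/cvgrPdist_le => /(_ _ Kt0)[m _ /(_ m (leqnn m))].
  rewrite /= sub0r normrN mul1r gtr0_norm ?half_pow_gt0// => hm.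
  exists m; apply: le_trans hm.
  have := half_pow_gt0 m; have := half_pow_le1 m; rewrite /rad => w1 w0.
  rewrite (exprS (2^-1 ^+ m) 5) mulrCA; apply: ler_piMr; first exact: ltW.
  apply: mulr_ile1; [exact/ltW/half_pow_gt0|exact/exprn_ge0/ltW|exact: half_pow_le1|].
  by apply: exprn_ile1 => //; exact: ltW.
case: (ex_minnP ex) => -[|k] km kmin.
  move: tk0; rewrite ltr_pdivlMr// mulrC => /lt_le_trans/(_ (rad_le _ _ (leq0n k0))).
  by rewrite ltNge km.
have kK : K * t < rad k.
  by rewrite ltNge; apply/negP => /kmin; rewrite ltnn.
exists k; split => //; rewrite leqNgt; apply/negP => kk0.
move: tk0; rewrite ltr_pdivlMr// mulrC => /lt_le_trans/(_ (rad_le _ _ kk0)).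
by rewrite ltNge km.
Qed.

End scales.

(** * Summation of the levels and comparison of energies at a good point *)

Theorem theorem1p3 (R : realType) (n : nat) (hn : (2 <= n)%N) :
  exists u : 'rV[R]_n -> R,
    [/\ continuous u, compactly_supported u & in_W1 n%:R u] /\
    exists E : set 'rV[R]_n,
      [/\ measurable E,
          (0 < lebesgue_rV n E)%E
        & forall x, E x -> forall K : R, 0 < K ->
            exists2 delta : R, 0 < delta &
              forall t : R, 0 < t -> t < delta ->
                differentiable (inf_convolution u t) x ->
                K < eucl_norm (gradient (inf_convolution u t) x)].
Proof.
have n0 : (0 < n)%N by exact: ltn_trans hn.
pose h k : R := (2^-1 ^+ k) ^+ 3.
have h0 k : 0 < h k by rewrite exprn_gt0// half_pow_gt0.
have /choice[vd vdP] (k : nat) : exists vd : ('rV[R]_n -> R) * ('I_n -> 'rV[R]_n -> R),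
    spikes n (32 ^ k) (rad k) (h k) ((4^-1 ^+ k) ^+ n) vd.1 vd.2.
  have h01 : 0 <= h k <= 1.
    rewrite (ltW (h0 k)) /h.
    by apply: exprn_ile1; [exact/ltW/half_pow_gt0|exact: half_pow_le1].
  have e0 : 0 < (4^-1 ^+ k) ^+ n :> R by rewrite !exprn_gt0// invr_gt0.
  have [v [d vdP]] :=
    spikes_exist n (32 ^ k) (rad k) (h k) _ hn (rad_gt0 k) (rad_mesh_le1 k) h01 e0.
  by exists (v, d).
pose v k := (vd k).1; pose d k := (vd k).2.
(* The grids lie in the unit cube and the radii are at most 1, so all levels are supported in one
   cube. *)
have near_grid k (x : 'rV[R]_n) : grid_nbhd n (32 ^ k) (rad k) x -> cube n 2 x.
  move=> xg i; have [a xa] := xg i.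
  have a1 : `|a%:R / (32 ^ k)%:R| <= 1 :> R.
    rewrite ger0_norm ?divr_ge0// ler_pdivrMr ?ltr0n ?expn_gt0// mul1r ler_nat.
    exact: leq_ord.
  have r1 : rad k <= 1 :> R.
    have := rad_mesh_le1 (R := R) k; have := rad_gt0 (R := R) k.
    have : 1 <= (32 ^ k)%:R :> R by rewrite ler1n expn_gt0.
    nra.
  by have := ler_normD (x ord0 i - a%:R / (32 ^ k)%:R) (a%:R / (32 ^ k)%:R); rewrite subrK; lra.
have vh k x : - h k <= v k x <= 0 by exact: spikes_range (vdP k) x.
have hle k : h k <= 2^-1 ^+ k.
  rewrite /h exprS; apply: ler_piMr; first exact/ltW/half_pow_gt0.
  by apply: exprn_ile1; [exact/ltW/half_pow_gt0|exact: half_pow_le1].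
have vB k x : `|v k x| <= 2^-1 ^+ k.
  have /andP[v1 v2] := vh k x; rewrite ler0_norm//.
  by apply: le_trans (hle k); rewrite lerNl.
pose u (x : 'rV[R]_n) := limn (series (v ^~ x)).
have uW : [/\ continuous u, compactly_supported u & in_W1 n%:R u].
  apply: (in_W1_series n 2 v d) => //.
  - by move=> k; exact: spikes_continuous (vdP k).
  - by move=> k i; exact: spikes_partial_continuous (vdP k) i.
  - by move=> k x; apply: contra_notP => /eqP/(spikes_support (vdP k))/near_grid.
  - by move=> k i x; apply: contra_notP => /eqP/(spikes_partial_support (vdP k))/near_grid.
  - by move=> k i x; exact: spikes_partial (vdP k) i x.
  - by move=> k i; exact: spikes_energy (vdP k) i.
exists u; split => //; exists (good_rV n); split.
- exact: measurable_good_rV.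
- exact: lebesgue_good_rV.
have u2 z : `|u z| <= 2.
  by rewrite -[2]mulr1; apply: lim_series_geometric_le => k; rewrite mul1r.
have cu : continuous u by case: uW.
move=> x Ex K K0.
(* The exponent 11 is that of [rad k.+1], which equals [2^-1 ^+ 11 * w ^+ 6] for [w = 2^-1 ^+ k].
   From level [k0] on, the penalty of the nearest grid point is then small enough for every [t] in
   the range of level [k]. *)
have [k0 k0P] : exists k0, n%:R * K * 2 ^+ 11 <= 2 ^+ k0.
  exists (Num.truncn (n%:R * K * 2 ^+ 11)).+1.
  apply: (le_trans (ltW (truncnS_gt _))).
  by move: (Num.truncn _).+1 => m; rewrite -natrX ler_nat ltnW// ltn_expl.
exists (rad k0 / K); first by rewrite divr_gt0// rad_gt0.
move=> t t0 tk0; have [k [k0k Ktk kKt]] := scale_exists k0 K t K0 t0 tk0.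
have xi01 i : 0 <= x ord0 i <= 1 by have [] := Ex i; rewrite /= in_itv.
have M0 : (0 < 32 ^ k)%N by rewrite expn_gt0.
have /choice[a aP] i := grid_approx (32 ^ k) (x ord0 i) M0 (xi01 i).
(* The competitor: a grid point of level [k] within one mesh of [x] in each coordinate. *)
pose p : 'rV[R]_n := \row_i ((a i)%:R / (32 ^ k)%:R).
set w : R := 2^-1 ^+ k.
have w0 : 0 < w by exact: half_pow_gt0.
have mesh : (32 ^ k)%:R^-1 = w ^+ 5.
  by apply: (mulfI (x := (32 ^ k)%:R)); rewrite ?mesh_pow ?mulfV// pnatr_eq0 -lt0n.
have xp : eucl_norm (x - p) ^+ 2 <= n%:R * w ^+ 10.
  rewrite sqr_eucl_norm; apply: (@le_trans _ _ (\sum_(i < n) w ^+ 10)).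
    apply: ler_sum => i _; rewrite !mxE [w ^+ 10](exprM w 5 2) -mesh.
    rewrite -[leLHS]real_normK ?num_real//.
    by apply: lerXn2r; rewrite ?nnegrE ?invr_ge0.
  by rewrite sumr_const card_ord mulr_natl.
have cvg_v z : cvgn (series (v ^~ z)).
  by apply: (@series_geometric_cvg _ _ 1) => j; rewrite mul1r.
(* All levels are nonpositive, so keeping only level [k], which attains its full depth at [p],
   bounds the sum from above. *)
have up : u p <= - w ^+ 3.
  apply: limr_le => //; near=> N.
  have kN : (k < N)%N by near: N; exact: nbhs_infty_gt.
  rewrite seriesEord/= (bigD1 (Ordinal kN))//=.
  have -> : v k p = - h k.
    by apply: (spikes_grid (vdP k)) => i; exists (a i); rewrite mxE.
  rewrite gerDl; apply: sumr_le0 => j _; by have /andP[] := vh j p.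
have uz z : eucl_norm (x - z) < rad k -> - (w ^+ 3 / 4) <= u z.
  move=> xz.
  have vz j : (j <= k)%N -> v j z = 0.
    move=> jk; apply/eqP; apply: contrapT => /negP.
    (* One coordinate suffices: a spike of level [j <= k] reaching [z] would put that coordinate of
       [x] within [rad k + rad j <= 2 * rad j] of a grid value, against the goodness of [x]. *)
    move=> /(spikes_support (vdP j)) /(_ (Ordinal n0))[b zb].
    have [_] := Ex (Ordinal n0); apply; exists j => //; exists b.
    have := coord_le_eucl_norm _ (x - z) (Ordinal n0); rewrite !mxE => xzi.
    have := ler_distD (z ord0 (Ordinal n0)) (x ord0 (Ordinal n0)) (b%:R / (32 ^ j)%:R).
    have := @rad_le R _ _ jk; lra.
  (* For [j > k] one factor [2^-1 ^+ j] of the depth is kept and the other two are frozen at [k.+1].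
     The tail [2 * B * 2^-1 ^+ k.+1] is then exactly a quarter of [w ^+ 3]. *)
  pose B : R := (2^-1 ^+ k.+1) ^+ 2.
  have vzB j : `|v j z| <= B * 2^-1 ^+ j.
    have [jk|kj] := leqP j k.
      by rewrite vz// normr0 mulr_ge0 ?sqr_ge0// ltW// half_pow_gt0.
    have /andP[v1 v2] := vh j z; rewrite ler0_norm//.
    apply: (@le_trans _ _ (h j)); first by rewrite lerNl.
    rewrite /h (exprSr (2^-1 ^+ j) 2) ler_pM2r ?half_pow_gt0//.
    apply: lerXn2r; [exact/ltW/half_pow_gt0|exact/ltW/half_pow_gt0|].
    by apply: ler_wiXn2l; rewrite ?invr_ge0// invf_le1 ?ler1n.
  have := lim_series_geometric _ _ vzB k.+1.
  rewrite (_ : series (v ^~ z) k.+1 = 0) ?subr0; last first.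
    by rewrite seriesEord/= big1// => j _; apply: vz; rewrite -ltnS.
  rewrite -/(u z) ler_norml => /andP[+ _]; apply: le_trans.
  by rewrite /B (exprS (2^-1 : R) k) -/w le_eqVlt; apply/orP; left; apply/eqP; field.
apply: (gradient_inf_convolution_gt _ u t 2 x p) => // z xz.
apply: (lt_le_trans _ (uz z (le_lt_trans xz Ktk))).
(* The penalty of [p] has to stay below the gap between [- w ^+ 3] and [- (w ^+ 3 / 4)]. *)
suff : eucl_norm (x - p) ^+ 2 / (2 * t) < 3 / 4 * w ^+ 3 by lra.
rewrite ltr_pdivrMr ?mulr_gt0//; apply: (le_lt_trans xp).
rewrite -(ltr_pM2r K0).
have wk0 : w <= 2^-1 ^+ k0.
  by apply: ler_wiXn2l; rewrite ?invr_ge0// invf_le1 ?ler1n.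
have nKw : n%:R * K * 2 ^+ 11 * w <= 1.
  apply: (@le_trans _ _ (2 ^+ k0 * 2^-1 ^+ k0)); last by rewrite -exprMn mulfV// expr1n.
  by apply: ler_pM => //; rewrite ?(ltW w0)// mulr_ge0 ?exprn_ge0// mulr_ge0// (ltW K0).
have w9 : 0 < w ^+ 9 by rewrite exprn_gt0.
have := ler_wpM2r (ltW w9) nKw; rewrite mul1r => nKw10.
(* The lower end of the range of [t] gives [w ^+ 3 * (K * t) >= 2^-1 ^+ 11 * w ^+ 9], and [nKw10]
   bounds [n%:R * w ^+ 10 * K] by the same quantity; the remaining factor [3 / 2] makes the
   inequality strict. *)
have := ler_wpM2l (ltW (exprn_gt0 3 w0)) kKt; rewrite /rad [2^-1 ^+ k.+1]exprS -/w => kKt'.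
have w9' : 0 < w ^+ 9 by [].
lra.
Unshelve. all: by end_near. Qed.
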